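(* Let $\mathbf{Z}=(\mathbf{Z}^{(1)},\dots,\mathbf{Z}^{(d)})$, $\mathbf{Z}^{(j)}=(Z^{(j,1)},\dots,Z^{(j,p_j)})$, be a $q$-dimensional random vector ($q=p_1+\dots+p_d$) in the max-domain of attraction of an extreme value distribution $H$ with extreme value copula $C$. The metric $\mathrm{SECO}(\mathbf{Z}^{(1)},\dots,\mathbf{Z}^{(d)})=\sum_{j=1}^d\theta(j)-\theta(1,\dots,d)$ satisfies the following properties. (A1) For every permutation $\pi$ of $\mathbf{Z}^{(1)},\dots,\mathbf{Z}^{(d)}$, $\mathrm{SECO}(\pi(\mathbf{Z}^{(1)},\dots,\mathbf{Z}^{(d)}))=\mathrm{SECO}(\mathbf{Z}^{(1)},\dots,\mathbf{Z}^{(d)})$; and for every $j\in\{1,\dots,d\}$ and every permutation $\pi_j$ of the components $Z^{(j,1)},\dots,Z^{(j,p_j)}$, $\mathrm{SECO}(\mathbf{Z}^{(1)},\dots,\pi_j(\mathbf{Z}^{(j)}),\dots,\mathbf{Z}^{(d)})=\mathrm{SECO}(\mathbf{Z}^{(1)},\dots,\mathbf{Z}^{(d)})$. (A2) $0\le \mathrm{SECO}(\mathbf{Z}^{(1)},\dots,\mathbf{Z}^{(d)})\le \min_{j=1,\dots,d}\big\{\sum_{k\neq j}\theta(k)\big\}$. (A3) $\mathrm{SECO}(\mathbf{Z}^{(1)},\dots,\mathbf{Z}^{(d)})=0$ if and only if $\mathbf{Z}^{(1)},\dots,\mathbf{Z}^{(d)}$ are mutually asymptotically independent. (A4) If $\mathbf{Z}^{(d+1)}$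 is a further random vector such that $(\mathbf{Z}^{(1)},\dots,\mathbf{Z}^{(d)},\mathbf{Z}^{(d+1)})$ is in the max-domain of attraction of an extreme value distribution, then $\mathrm{SECO}(\mathbf{Z}^{(1)},\dots,\mathbf{Z}^{(d)},\mathbf{Z}^{(d+1)})\ge \mathrm{SECO}(\mathbf{Z}^{(1)},\dots,\mathbf{Z}^{(d)})$, with equality if and only if $\mathbf{Z}^{(d+1)}$ is asymptotically independent of $(\mathbf{Z}^{(1)},\dots,\mathbf{Z}^{(d)})$. (A5) $\mathrm{SECO}(\mathbf{Z}^{(1)},\dots,\mathbf{Z}^{(d)})$ is well defined for every such $\mathbf{Z}$ and is a functional solely of the extreme value copula $C$ (and of the block sizes $p_1,\dots,p_d$). (A6) If $T^{(j,\ell)}$, $j=1,\dots,d$, $\ell=1,\dots,p_j$, are strictly increasing continuous transformations and $\mathbf{T}^{(j)}(\mathbf{Z}^{(j)})=(T^{(j,1)}(Z^{(j,1)}),\dots,T^{(j,p_j)}(Z^{(j,p_j)}))$, then $\mathrm{SECO}(\mathbf{T}^{(1)}(\mathbf{Z}^{(1)}),\dots,\mathbf{T}^{(d)}(\mathbf{Z}^{(d)}))=\mathrm{SECO}(\mathbf{Z}^{(1)},\dots,\mathbf{Z}^{(d)})$. (A8) Let $(\mathbf{Z}_n)_{n\in\mathbb{N}}$ be a sequence of $q$-dimensional random vectors (with the same block sizes $p_1,\dots,p_d$) such that each $\mathbf{Z}_n$ is in the max-domain of attraction of an extreme value distribution $H_n$ with extreme value copula $C_n$. If $C_n\to C$ uniformly,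 then $\lim_{n\to\infty}\mathrm{SECO}(\mathbf{Z}_n^{(1)},\dots,\mathbf{Z}_n^{(d)})=\mathrm{SECO}(\mathbf{Z}^{(1)},\dots,\mathbf{Z}^{(d)})$.
   Context: $\mathbf{Z}$ has distribution function $F$ with univariate margins $F^{(j,\ell)}$ (the distribution function of $Z^{(j,\ell)}$). $F$ (or $\mathbf{Z}$) is in the max-domain of attraction of the extreme value distribution $H$ if, for suitable normalising functions (nondecreasing, right-continuous, tending to $\pm\infty$ at $\pm\infty$) applied componentwise, the componentwise maxima of $\mathbf{Z}_1,\dots,\mathbf{Z}_n$ (observations with law $F$) satisfy $\mathbb{P}\{\bigvee_{i=1}^n \mathbf{Z}_i\le \mathbf{u}_n(\mathbf{x})\}\to H(\mathbf{x})$ for $\mathbf{x}\in\mathbb{R}^q$. The margins $H^{(j,\ell)}$ of $H$ are univariate extreme value distributions and $-\ln H(\mathbf{x})=L(-\ln H^{(1,1)}(x^{(1,1)}),\dots,-\ln H^{(d,p_d)}(x^{(d,p_d)}))$, where the stable tail dependence function $L:[0,\infty)^q\to[0,\infty)$ is obtained from $F$ by $$L(\mathbf{x})=\lim_{t\downarrow 0}t^{-1}\mathbb{P}\{F^{(1,1)}(Z^{(1,1)})>1-tx^{(1,1)}\text{ or }\dots\text{ or }F^{(d,p_d)}(Z^{(d,p_d)})>1-tx^{(d,p_d)}\}.$$ The extreme value copula of $H$ is $C(u^{(1,1)},\dots,u^{(d,p_d)})=\exp\{-L(-\ln u^{(1,1)},\dots,-\ln u^{(d,p_d)})\}$. Extremal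 coefficients: $$\theta(1,\dots,d)=\lim_{t\downarrow0}t^{-1}\mathbb{P}\{\max_{j=1,\dots,d}\max_{\ell=1,\dots,p_j}F^{(j,\ell)}(Z^{(j,\ell)})>1-t\},\qquad \theta(j)=\lim_{t\downarrow0}t^{-1}\mathbb{P}\{\max_{\ell=1,\dots,p_j}F^{(j,\ell)}(Z^{(j,\ell)})>1-t\}.$$ For $d+1$ vectors, $\mathrm{SECO}$ is defined by the same formula with $d$ replaced by $d+1$. Asymptotic independence: $\mathbf{Z}^{(1)},\dots,\mathbf{Z}^{(d)}$ are mutually asymptotically independent if $H=\prod_{j=1}^d H^{(j)}$, where $H^{(j)}$ is the margin of $H$ on the coordinates of $\mathbf{Z}^{(j)}$; $\mathbf{Z}^{(d+1)}$ is asymptotically independent of $(\mathbf{Z}^{(1)},\dots,\mathbf{Z}^{(d)})$ if the limiting extreme value distribution of $(\mathbf{Z}^{(1)},\dots,\mathbf{Z}^{(d+1)})$ is the product of its margin on the coordinates of $(\mathbf{Z}^{(1)},\dots,\mathbf{Z}^{(d)})$ and its margin on the coordinates of $\mathbf{Z}^{(d+1)}$. *)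

(* Defs.v *)
(* MathComp-Analysis *)
From HB Require Import structures.
From mathcomp Require Export all_boot all_order all_algebra all_fingroup.
From mathcomp Require Export all_classical all_reals all_analysis.
Set Implicit Arguments.
Unset Strict Implicit.
Unset Printing Implicit Defensive.
Export Order.TTheory GRing.Theory Num.Theory.
Export numFieldNormedType.Exports.

Global Open Scope classical_set_scope.
Global Open Scope ring_scope.

(* A vector with d blocks of sizes p 0, ..., p (d - 1), with entries in T; the
   coordinate written (j, l) on paper is [x j l]. *)
Definition blocks (d : nat) (p : 'I_d -> nat) (T : Type) : Type :=
  forall j : 'I_d, 'I_(p j) -> T.

Definition same_coord (d : nat) (p : 'I_d -> nat)
    (j : 'I_d) (l : 'I_(p j)) (k : 'I_d) (m : 'I_(p k)) : bool :=
  Tagged (fun i => 'I_(p i)) m == Tagged (fun i => 'I_(p i)) l.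

(** Distribution functions on R^q *)

Definition joint_cdf (R : realType) (d : nat) (p : 'I_d -> nat)
    (dsp : measure_display) (T : measurableType dsp) (P : probability T R)
    (Z : blocks p {RV P >-> R}) (x : blocks p R) : R :=
  fine (P [set w | forall j l, Z j l w <= x j l]).

Definition is_df (R : realType) (d : nat) (p : 'I_d -> nat)
    (H : blocks p R -> R) : Prop :=
  exists (dsp : measure_display) (T : measurableType dsp) (P : probability T R)
    (V : blocks p {RV P >-> R}), forall x, H x = joint_cdf V x.

(* Margin of H on the coordinates selected by A: the other coordinates are sent
   to +oo.  It is kept as a function of the whole vector x, of which only the
   selected coordinates matter. *)
Definition margin (R : realType) (d : nat) (p : 'I_d -> nat)
    (H : blocks p R -> R) (A : forall j : 'I_d, 'I_(p j) -> bool)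
    (x : blocks p R) : R :=
  lim (H (fun j l => if A j l then x j l else t) @[t --> +oo]).

(* Max-stability: for each n >= 1, H^n is of the same (affine) type as H. *)
Definition max_stable (R : realType) (d : nat) (p : 'I_d -> nat)
    (H : blocks p R -> R) : Prop :=
  forall n : nat, (0 < n)%N ->
  exists a b : blocks p R,
    (forall j l, 0 < a j l) /\
    (forall x, H (fun j l => a j l * x j l + b j l) ^+ n = H x).

(* A univariate distribution function is that of a point mass iff it takes only
   the values 0 and 1. *)
Definition nondegenerate_margins (R : realType) (d : nat) (p : 'I_d -> nat)
    (H : blocks p R -> R) : Prop :=
  forall (j : 'I_d) (l : 'I_(p j)), exists x : blocks p R,
    0 < margin H (fun k m => same_coord l m) x < 1.

Definition extreme_value_df (R : realType) (d : nat) (p : 'I_d -> nat)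
    (H : blocks p R -> R) : Prop :=
  [/\ is_df H, nondegenerate_margins H & max_stable H].

(** Independent copies and max-domain of attraction *)

Definition sigma_generated (R : realType) (d : nat) (p : 'I_d -> nat)
    (dsp : measure_display) (T : measurableType dsp) (P : probability T R)
    (Y : blocks p {RV P >-> R}) : set (set T) :=
  <<s [set A | exists j l (B : set R), measurable B /\ A = Y j l @^-1` B] >>.

Definition independent_seq (R : realType) (d : nat) (p : 'I_d -> nat)
    (dsp : measure_display) (T : measurableType dsp) (P : probability T R)
    (Y : nat -> blocks p {RV P >-> R}) : Prop :=
  forall (n : nat) (A : nat -> set T),
    (forall i, (i < n)%N -> sigma_generated (Y i) (A i)) ->
    fine (P (\bigcap_(i in [set i | (i < n)%N]) A i))
      = \prod_(i < n) fine (P (A i)).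

Definition iid_copies (R : realType) (d : nat) (p : 'I_d -> nat)
    (dsp : measure_display) (T : measurableType dsp) (P : probability T R)
    (Z : blocks p {RV P >-> R})
    (dsp' : measure_display) (T' : measurableType dsp') (P' : probability T' R)
    (Y : nat -> blocks p {RV P' >-> R}) : Prop :=
  (forall i x, joint_cdf (Y i) x = joint_cdf Z x) /\ independent_seq Y.

Definition normalising (R : realType) (u : R -> R) : Prop :=
  [/\ nondecreasing_fun u, right_continuous u,
      u x @[x --> +oo] --> +oo & u x @[x --> -oo] --> -oo].

(* For n > 0 the maximum of the first n copies; the copy number 0 used as
   initial value is one of them. *)
Definition copies_max (R : realType) (d : nat) (p : 'I_d -> nat)
    (dsp : measure_display) (T : measurableType dsp) (P : probability T R)
    (Y : nat -> blocks p {RV P >-> R}) (n : nat)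
    (j : 'I_d) (l : 'I_(p j)) (w : T) : R :=
  \big[Num.max/Y 0%N j l w]_(i < n) Y i j l w.

Definition in_mda (R : realType) (d : nat) (p : 'I_d -> nat)
    (dsp : measure_display) (T : measurableType dsp) (P : probability T R)
    (Z : blocks p {RV P >-> R}) (H : blocks p R -> R) : Prop :=
  extreme_value_df H /\
  exists (dsp' : measure_display) (T' : measurableType dsp')
    (P' : probability T' R) (Y : nat -> blocks p {RV P' >-> R})
    (u : nat -> blocks p (R -> R)),
    [/\ iid_copies Z Y,
        forall n j l, normalising (u n j l) &
        forall x : blocks p R,
          fine (P' [set w | forall j l,
                      copies_max Y n l w <= u n j l (x j l)])
            @[n --> \oo] --> H x].

(** Stable tail dependence function and extreme value copula *)

Definition unif_margin (R : realType) (d : nat) (p : 'I_d -> nat)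
    (dsp : measure_display) (T : measurableType dsp) (P : probability T R)
    (Z : blocks p {RV P >-> R}) (j : 'I_d) (l : 'I_(p j)) (w : T) : R :=
  fine (cdf (Z j l) (Z j l w)).

Definition stdf (R : realType) (d : nat) (p : 'I_d -> nat)
    (dsp : measure_display) (T : measurableType dsp) (P : probability T R)
    (Z : blocks p {RV P >-> R}) (x : blocks p R) : R :=
  lim (t^-1 * fine (P [set w | exists j l,
                         unif_margin Z l w > 1 - t * x j l]) @[t --> 0^'+]).

(* exp (- L (- ln u)) on ]0, 1]^q, extended by 0 on the rest of [0, 1]^q, where
   some - ln (u j l) is +oo.  Outside [0, 1]^q the value is also 0, so that the
   function carries no more information than the copula itself. *)
Definition ev_copula (R : realType) (d : nat) (p : 'I_d -> nat)
    (dsp : measure_display) (T : measurableType dsp) (P : probability T R)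
    (Z : blocks p {RV P >-> R}) (u : blocks p R) : R :=
  if [forall j, forall l, 0 < u j l <= 1]
  then expR (- stdf Z (fun j l => - ln (u j l))) else 0.

Definition unif_cube_cvg (R : realType) (d : nat) (p : 'I_d -> nat)
    (Cn : nat -> blocks p R -> R) (C : blocks p R -> R) : Prop :=
  forall e : R, 0 < e -> \forall n \near \oo,
    forall u : blocks p R, (forall j l, 0 <= u j l <= 1) ->
      `|Cn n u - C u| < e.

(** Extremal coefficients and SECO *)

(* The values of [unif_margin] are nonnegative, so 0 is a neutral initial value
   for the maxima over nonempty families. *)
Definition joint_excess (R : realType) (d : nat) (p : 'I_d -> nat)
    (dsp : measure_display) (T : measurableType dsp) (P : probability T R)
    (Z : blocks p {RV P >-> R}) (t : R) : R :=
  t^-1 * fine (P [set w | \big[Num.max/0]_(j < d) \big[Num.max/0]_(l < p j)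
                            unif_margin Z l w > 1 - t]).

Definition block_excess (R : realType) (d : nat) (p : 'I_d -> nat)
    (dsp : measure_display) (T : measurableType dsp) (P : probability T R)
    (Z : blocks p {RV P >-> R}) (j : 'I_d) (t : R) : R :=
  t^-1 * fine (P [set w | \big[Num.max/0]_(l < p j)
                            unif_margin Z l w > 1 - t]).

Definition theta_joint (R : realType) (d : nat) (p : 'I_d -> nat)
    (dsp : measure_display) (T : measurableType dsp) (P : probability T R)
    (Z : blocks p {RV P >-> R}) : R :=
  lim (joint_excess Z t @[t --> 0^'+]).

Definition theta (R : realType) (d : nat) (p : 'I_d -> nat)
    (dsp : measure_display) (T : measurableType dsp) (P : probability T R)
    (Z : blocks p {RV P >-> R}) (j : 'I_d) : R :=
  lim (block_excess Z j t @[t --> 0^'+]).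

(* [lim] is a total operator: this is the existence of the limits that enter
   [seco]. *)
Definition seco_well_defined (R : realType) (d : nat) (p : 'I_d -> nat)
    (dsp : measure_display) (T : measurableType dsp) (P : probability T R)
    (Z : blocks p {RV P >-> R}) : Prop :=
  cvg (joint_excess Z t @[t --> 0^'+]) /\
  forall j, cvg (block_excess Z j t @[t --> 0^'+]).

Definition seco (R : realType) (d : nat) (p : 'I_d -> nat)
    (dsp : measure_display) (T : measurableType dsp) (P : probability T R)
    (Z : blocks p {RV P >-> R}) : R :=
  \sum_(j < d) theta Z j - theta_joint Z.

(** Asymptotic independence *)

Definition mutually_asymp_indep (R : realType) (d : nat) (p : 'I_d -> nat)
    (H : blocks p R -> R) : Prop :=
  forall x, H x = \prod_(j < d) margin H (fun k _ => k == j) x.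

(* One more block, at index [ord_max] of 'I_d.+1; [unlift ord_max] is None there
   and Some j at the image of j : 'I_d. *)
Definition rcons_size (d : nat) (p : 'I_d -> nat) (m : nat) : 'I_d.+1 -> nat :=
  fun k => if unlift ord_max k is Some j then p j else m.

Definition rcons_block (d : nat) (p : 'I_d -> nat) (m : nat) (T : Type)
    (x : blocks p T) (y : 'I_m -> T) : blocks (rcons_size p m) T :=
  fun k => match unlift ord_max k as o
                 return 'I_(if o is Some j then p j else m) -> T with
           | Some j => x j
           | None => y
           end.

Definition asymp_indep_last (R : realType) (d : nat) (p : 'I_d.+1 -> nat)
    (K : blocks p R -> R) : Prop :=
  forall x, K x = margin K (fun k _ => k != ord_max) x
                  * margin K (fun k _ => k == ord_max) x.

(* Main.v *)
(* Let Z be attracted by the max-stable law of V, so that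
   P(Z <= u_n(y))^n -> P(V <= y).  The values of a margin of V are closed under
   positive rational powers, hence dense in [0, 1].  Therefore, when
   -ln P(V_i <= y_i) = x_i, the event F_i(Z_i) > 1 - t x_i is squeezed between
   events Z_i > u_n(z_i) with n of order 1 / t and z as close to y as desired;
   no continuity of F is required.  This gives, for every set A of coordinates,
     t^-1 P(F_i(Z_i) > 1 - t x_i for some i in A) -> - ln P(V_i <= y_i, i in A).
   For a partition of the coordinates into blocks, the sum of the excess
   probabilities of the blocks minus that of their union is nonnegative,
   nondecreasing in x (subadditivity) and homogeneous of degree one in the
   limit, so that it vanishes at x = 1 iff it vanishes everywhere, which is the
   factorization of the limit law.  (A3) is the case of the d blocks, (A4) that
   of the partition into the first d blocks and the new one.  Finally the
   extremal coefficients are - ln C at points with coordinates e^-1 and 1,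
   which gives (A5) and (A8). *)
Require Import Defs.
From mathcomp Require Import ring lra measurable_realfun.
Set Implicit Arguments.
Unset Strict Implicit.
Unset Printing Implicit Defensive.

(** * Union bounds and tails of random vectors *)


Section union_bounds.
Context (R : realType) (dsp : measure_display) (T : measurableType dsp)
  (P : probability T R) (I : finType).
Implicit Types (A : pred I) (B C : I -> set T) (E F : set T).

Definition prob E : R := fine (P E).

Definition union_over A B : set T := [set w | exists i, A i /\ B i w].

Lemma prob_ge0 E : 0 <= prob E.
Proof. exact/fine_ge0. Qed.

Lemma le_prob E F : measurable E -> measurable F -> E `<=` F ->
  prob E <= prob F.
Proof.
move=> mE mF EF; rewrite /prob fine_le ?fin_num_measure//.
by rewrite le_measure ?inE.
Qed.

Lemma prob_le1 E : measurable E -> prob E <= 1.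
Proof.
move=> mE; have -> : 1 = prob setT by rewrite /prob probability_setT.
exact: le_prob.
Qed.

Lemma prob_setC E : measurable E -> prob (~` E) = 1 - prob E.
Proof.
by move=> mE; rewrite /prob probability_setC// fineB// fin_num_measure.
Qed.

Lemma prob_setU_le E F : measurable E -> measurable F ->
  prob (E `|` F) <= prob E + prob F.
Proof.
move=> mE mF; rewrite /prob -fineD ?fin_num_measure// fine_le//.
- by rewrite fin_num_measure//; exact: measurableU.
- by rewrite fin_numD !fin_num_measure.
- exact: measureU2.
Qed.

Lemma measurable_union_over A B :
  (forall i, measurable (B i)) -> measurable (union_over A B).
Proof.
move=> mB; have -> : union_over A B = \bigcup_(i in [set` A]) B i.
  by apply/seteqP; split => w; [case=> i [? ?]; exists i|case=> i ? ?; exists i].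
by apply: fin_bigcup_measurable => //; exact: finite_finset.
Qed.

Lemma union_bound A B : (forall i, measurable (B i)) ->
  prob (union_over A B) <= \sum_(i | A i) prob (B i).
Proof.
move=> mB; suff H (s : seq I) :
    prob (union_over (fun i => (i \in s) && A i) B) <= \sum_(i <- s | A i) prob (B i).
  have := H (index_enum I); congr (prob _ <= _); apply/seteqP; split=> w.
    by case=> i [/andP[_ ?] ?]; exists i.
  by case=> i [? ?]; exists i; rewrite mem_index_enum.
elim: s => [|a s ih].
  rewrite big_nil.
  by rewrite (_ : union_over _ _ = set0) /prob ?measure0// -subset0 => w -[i []].
rewrite big_cons; case: ifPn => Aa.
  apply: (le_trans _ (lerD (lexx _) ih)); apply: (le_trans _ (prob_setU_le _ _)) => //.
    apply: le_prob; first exact: measurable_union_over.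
      by apply: measurableU => //; exact: measurable_union_over.
    move=> w [i [/andP[+ Ai] Bi]]; rewrite inE => /orP[/eqP <-|si]; first by left.
    by right; exists i; rewrite si.
  exact: measurable_union_over.
apply: le_trans ih; apply: le_prob; [exact: measurable_union_over..|].
move=> w [i [/andP[+ Ai] Bi]]; rewrite inE => /orP[/eqP ia|si].
  by move: Aa; rewrite -ia Ai.
by exists i; rewrite si.
Qed.

(** The new part of the union lies in the union of the differences. This bounds variations of joint
    tails by marginal ones, and makes the defect of the union bound monotone. *)
Lemma union_increment A B C :
  (forall i, measurable (B i)) -> (forall i, measurable (C i)) ->
  (forall i, A i -> B i `<=` C i) ->
  prob (union_over A C) - prob (union_over A B)
    <= \sum_(i | A i) (prob (C i) - prob (B i)).
Proof.
move=> mB mC BC.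
have mCB i : measurable (C i `\` B i) by exact: measurableD.
have -> : \sum_(i | A i) (prob (C i) - prob (B i)) = \sum_(i | A i) prob (C i `\` B i).
  apply: eq_bigr => i /BC BCi; apply/eqP; rewrite eq_le; apply/andP; split.
    rewrite lerBlDr; apply: (le_trans _ (prob_setU_le _ _)) => //.
    apply: le_prob => //; first exact: measurableU.
    by move=> w Cw; have [Bw|nBw] := pselect (B i w); [right|left].
  rewrite lerBrDr /prob -fineD ?fin_num_measure// -measureU//.
    by rewrite setUC setDUK.
  by rewrite -subset0 => w [[_ nB] /nB].
apply: (le_trans _ (union_bound A mCB)).
rewrite lerBlDr; apply: (le_trans _ (prob_setU_le _ _)); last 2 first.
- exact: measurable_union_over.
- exact: measurable_union_over.
apply: le_prob; first exact: measurable_union_over.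
  by apply: measurableU; exact: measurable_union_over.
move=> w [i [Ai Cw]]; have [Bw|nBw] := pselect (B i w); [right|left]; exists i => //.
Qed.

End union_bounds.

(** * Exceedance probabilities of a vector over a finite index set *)

Section tails.
Context (R : realType) (dsp : measure_display) (T : measurableType dsp)
  (P : probability T R) (I : finType) (X : I -> {RV P >-> R}).
Implicit Types (A B : pred I) (y z : I -> R).

(** One minus the distribution function of the margin on [A]. Unions of exceedances give margins
    without limits and put subadditivity at hand. *)
Definition tail A y : R := prob P (union_over A (fun i => [set w | y i < X i w])).

Definition tail1 (i : I) (r : R) : R := prob P [set w | r < X i w].

Lemma measurable_tail1 i r : measurable [set w | r < X i w].
Proof.
rewrite (_ : [set _ | _] = X i @^-1` `]r, +oo[); last first.
  by apply/seteqP; split => w /=; rewrite in_itv/= andbT.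
exact: measurable_funPTI.
Qed.

Lemma measurable_tail A y :
  measurable (union_over A (fun i => [set w | y i < X i w])).
Proof. by apply: measurable_union_over => i; exact: measurable_tail1. Qed.

Hint Resolve measurable_tail1 measurable_tail : core.

Lemma tail_ge0 A y : 0 <= tail A y. Proof. exact: prob_ge0. Qed.
Lemma tail_le1 A y : tail A y <= 1. Proof. exact: prob_le1. Qed.
Lemma tail1_ge0 i r : 0 <= tail1 i r. Proof. exact: prob_ge0. Qed.
Lemma tail1_le1 i r : tail1 i r <= 1. Proof. exact: prob_le1. Qed.

Lemma tail1_le i r s : r <= s -> tail1 i s <= tail1 i r.
Proof. by move=> rs; apply: le_prob => // w; exact: le_lt_trans. Qed.

Lemma tail_pred1 i y : tail (pred1 i) y = tail1 i (y i).
Proof.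
congr prob; apply/seteqP; split => w /=; first by move=> [j [/eqP ->]].
by move=> rX; exists i; split => //=; exact: eqxx.
Qed.

Lemma tail_sub A B y : (forall i, A i -> B i) -> tail A y <= tail B y.
Proof. by move=> AB; apply: le_prob => // w [i [/AB ? ?]]; exists i. Qed.

Lemma tail1_le_tail A y i : A i -> tail1 i (y i) <= tail A y.
Proof. by move=> Ai; apply: le_prob => // w ?; exists i. Qed.

Lemma tail_le_sum A y : tail A y <= \sum_(i | A i) tail1 i (y i).
Proof. exact: union_bound. Qed.

Lemma eq_tail A B y z : A =1 B -> (forall i, A i -> y i = z i) ->
  tail A y = tail B z.
Proof.
move=> AB yz; congr prob; apply/seteqP; split => w [i [Ai]] /=.
  by rewrite yz// => ?; exists i; rewrite -AB.
by move: Ai; rewrite -AB => Ai; rewrite -yz// => ?; exists i.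
Qed.

Lemma tail_predU A B y :
  tail (predU A B) y <= tail A y + tail B y.
Proof.
apply: (le_trans _ (prob_setU_le _ _ _)) => //; apply: le_prob => //.
  exact: measurableU.
by move=> w [i [/= /orP[]]]; [left|right]; exists i.
Qed.

Lemma tail_increment A y z : (forall i, A i -> y i <= z i) ->
  tail A y - tail A z <= \sum_(i | A i) (tail1 i (y i) - tail1 i (z i)).
Proof.
move=> yz; apply: union_increment => // i Ai w /=.
by apply: le_lt_trans; exact: yz.
Qed.

Lemma tail_le A y z : (forall i, A i -> y i <= z i) -> tail A z <= tail A y.
Proof.
move=> yz; apply: le_prob => // w [i [Ai /= zX]]; exists i; split => //=.
by apply: le_lt_trans zX; exact: yz.
Qed.

Lemma tail1_cvg0 i : tail1 i r @[r --> +oo] --> (0 : R).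
Proof.
have H := @cvg_ccdfy0 _ _ _ P (X i).
have := fine_cvg H; rewrite /= => H'.
have -> : tail1 i = (fun r => fine (ccdf (X i) r)); last exact: H'.
apply/funext => r; rewrite /tail1 /prob /ccdf /distribution /pushforward.
congr (fine (P _)); apply/seteqP; split => w /=; by rewrite in_itv/= andbT.
Qed.

Lemma tail_cvg0 A (s : R -> I -> R) :
  (forall i, s t i @[t --> +oo] --> +oo) -> tail A (s t) @[t --> +oo] --> (0 : R).
Proof.
move=> sy; apply: (@squeeze_cvgr _ _ _ _ (fun=> 0) (fun t => \sum_(i | A i) tail1 i (s t i))).
- by near=> t; rewrite tail_ge0 tail_le_sum.
- exact: cvg_cst.
- rewrite [X in _ --> X](_ : _ = \sum_(i | A i) (0 : R)); last by rewrite big1.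
  apply: cvg_big => [|i _]; first exact: add_continuous.
  exact: (cvg_comp _ _ (sy i) (@tail1_cvg0 i)).
Unshelve. all: by end_near. Qed.

(** The discarded coordinates add at most their own tail, which vanishes. A general path [s] is
    allowed because max-stability replaces [t] by an affine function of [t]. *)
Lemma tail_cvg_margin A z (s : R -> I -> R) :
  (forall i, ~~ A i -> s t i @[t --> +oo] --> +oo) ->
  tail predT (fun i => if A i then z i else s t i) @[t --> +oo] --> tail A z.
Proof.
move=> sy; apply: (@squeeze_cvgr _ _ _ _ (fun=> tail A z)
  (fun t => tail A z + tail (predC A) (fun i => if A i then t else s t i))).
- near=> t.
  set v := (fun i => if A i then z i else s t i).
  have -> : tail A z = tail A v by apply: eq_tail => // i Ai; rewrite /v Ai.
  have -> : tail (predC A) (fun i => if A i then t else s t i) = tail (predC A) v.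
    by apply: eq_tail => // i /negbTE Ai; rewrite /v Ai.
  rewrite tail_sub//=; have -> : tail predT v = tail (predU A (predC A)) v.
    by apply: eq_tail => // i /=; rewrite orbN.
  exact: tail_predU.
- exact: cvg_cst.
- rewrite -[X in _ --> X]addr0; apply: cvgD; first exact: cvg_cst.
  apply: tail_cvg0 => i; case: (boolP (A i)) => [_|]; [exact: cvg_id|exact: sy].
Unshelve. all: by end_near. Qed.

End tails.

(** * Convergence of powers of distribution functions *)


Section real_sequences.
Variable R : realType.
Implicit Types (a b c h x : R) (f : nat -> R).

(** If a = P(E), c = P(F) and b = P(E and F), then a - b <= 1 - c; this is the same bound for n
    independent copies, with no copies constructed. *)
Lemma expr_gap (n : nat) a b c : 0 <= b -> b <= a -> a <= 1 -> b <= c -> c <= 1 ->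
  a - b <= 1 - c -> a ^+ n - b ^+ n <= 1 - c ^+ n.
Proof.
move=> b0 ba a1 bc c1 abc; have a0 := le_trans b0 ba; have c0 := le_trans b0 bc.
elim: n => [|n ih]; first by rewrite !expr0 !subrr.
have -> : a ^+ n.+1 - b ^+ n.+1 = a ^+ n * (a - b) + b * (a ^+ n - b ^+ n).
  by rewrite !exprS; ring.
have -> : 1 - c ^+ n.+1 = (1 - c) + c * (1 - c ^+ n) by rewrite exprS; ring.
apply: lerD.
  by apply: le_trans abc; rewrite ler_piMl ?subr_ge0// exprn_ile1.
apply: (@le_trans _ _ (b * (1 - c ^+ n))); first exact: ler_wpM2l.
by apply: ler_wpM2r => //; rewrite subr_ge0 exprn_ile1.
Qed.

Lemma ln_le_sub1 x : 0 < x -> ln x <= x - 1.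
Proof. by move=> x0; rewrite -[in leLHS](subrKC 1 x); apply: le_ln1Dx; lra. Qed.

Lemma ln_ge_inv x : 0 < x -> x - 1 <= x * ln x.
Proof.
move=> x0; have := ln_le_sub1 (x := x^-1); rewrite invr_gt0 => /(_ x0).
rewrite lnV ?posrE// -(ler_pM2l x0) mulrBr mulfV ?gt_eqF//; lra.
Qed.

Lemma cvg_invn : (n%:R^-1 : R) @[n --> \oo] --> 0.
Proof. by rewrite -cvg_shiftS; exact: cvg_harmonic. Qed.

(** Taking logarithms, n times - ln (f n) converges; hence f tends to 1, where 1 - f and - ln f
    agree to first order. *)
Lemma cvg_expr_ln f h : 0 < h -> (forall n, 0 <= f n <= 1) ->
  f n ^+ n @[n --> \oo] --> h ->
  (1 - f n) @[n --> \oo] --> 0 /\ n%:R * (1 - f n) @[n --> \oo] --> - ln h.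
Proof.
move=> h0 f01 fh.
have fgt0 : \forall n \near \oo, 0 < f n.
  near=> n; have n0 : (0 < n)%N by near: n; exact: nbhs_infty_gt.
  have fn0 : 0 < f n ^+ n by near: n; exact: cvgr_gt fh _ h0.
  have /andP[+ _] := f01 n; rewrite le_eqVlt => /orP[/eqP f0|//].
  by move: fn0; rewrite -f0 expr0n eqn0Ngt n0 ltxx.
pose s n := n%:R * - ln (f n).
have sh : s n @[n --> \oo] --> - ln h.
  have : - ln (f n ^+ n) @[n --> \oo] --> - ln h.
    by apply: cvgN; exact: (cvg_comp _ _ fh (continuous_ln h0)).
  apply: cvg_trans; apply: near_eq_cvg; apply: filterS fgt0 => n n0.
  by rewrite /s lnXn// mulrN mulr_natl.
have sn0 : s n * n%:R^-1 @[n --> \oo] --> 0.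
  by rewrite -[X in _ --> X](mulr0 (- ln h)); exact: cvgM sh cvg_invn.
have sE : \forall n \near \oo, s n * n%:R^-1 = - ln (f n).
  near=> n; rewrite /s mulrAC mulfV ?mul1r// pnatr_eq0 -lt0n.
  by near: n; exact: nbhs_infty_gt.
split.
  apply: (squeeze_cvgr _ (cvg_cst 0) sn0); near=> n.
  have fn0 : 0 < f n by near: n.
  rewrite (near sE n)//; have := f01 n; have := ln_le_sub1 fn0; lra.
(* With l = ln (f n), the two logarithmic inequalities give - l - l^2 <= 1 - f n <= - l, to be
   multiplied by n. *)
apply: (@squeeze_cvgr _ _ _ _ (fun n => s n - s n * (s n * n%:R^-1)) s) => //; last first.
  rewrite -[X in _ --> X]subr0 -(mulr0 (- ln h)).
  by apply: cvgB => //; exact: cvgM.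
near=> n.
have fn0 : 0 < f n by near: n.
rewrite (near sE n)// /s -mulrA.
set l := ln (f n).
have -> : n%:R * - l - n%:R * (- l * - l) = n%:R * (- l * (1 + l)) :> R by ring.
have l1 : l <= f n - 1 := ln_le_sub1 fn0.
have l2 : f n - 1 <= f n * l := ln_ge_inv fn0.
have := f01 n => /andP[_ f1].
by apply/andP; split; apply: ler_wpM2l => //; nra.
Unshelve. all: by end_near. Qed.

End real_sequences.

(** * Attraction and its transfer to margins *)

Section attraction.
Context (R : realType) (I : finType).
Context (dspZ : measure_display) (TZ : measurableType dspZ)
  (PZ : probability TZ R) (Z : I -> {RV PZ >-> R}).
Context (dspV : measure_display) (TV : measurableType dspV)
  (PV : probability TV R) (V : I -> {RV PV >-> R}).

Definition attracted : Prop := exists u : nat -> I -> R -> R,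
  forall x : I -> R,
    (1 - tail Z predT (fun i => u n i (x i))) ^+ n @[n --> \oo]
      --> 1 - tail V predT x.

(** Limits in [n] and in the discarded coordinates cannot simply be exchanged. [expr_gap] bounds the
    cost of keeping these coordinates at a finite level [t] by a quantity whose limit in [n] is
    small for large [t]. *)
Lemma attracted_margin (u : nat -> I -> R -> R) :
  (forall x : I -> R,
    (1 - tail Z predT (fun i => u n i (x i))) ^+ n @[n --> \oo]
      --> 1 - tail V predT x) ->
  forall (A : pred I) (x : I -> R),
    (1 - tail Z A (fun i => u n i (x i))) ^+ n @[n --> \oo]
      --> 1 - tail V A x.
Proof.
move=> uV A x; apply/cvgrPdist_le => e e0.
have e4 : 0 < e / 4 by rewrite divr_gt0.
pose xt t i := if A i then x i else t.
have idy : (t : R) @[t --> +oo] --> +oo by exact: cvg_id.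
(* A quarter of [e] goes to each of these two estimates for the limit law, and one to each of the
   convergences [hb] and [hc]. *)
have [t [t1 t2]] : exists t : R,
    tail V predT (xt t) <= tail V A x + e / 4 /\ tail V predT (fun=> t) <= e / 4.
  near +oo_R => t; exists t; split; near: t.
    have /cvgr_le H := @tail_cvg_margin _ _ _ _ _ V A x (fun t _ => t) (fun i _ => idy).
    by apply: H; rewrite ltrDl.
  have /cvgr_le H := @tail_cvg0 _ _ _ _ _ V predT (fun t _ => t) (fun i => idy).
  exact: H.
have t3 : tail V A x <= tail V predT (xt t).
  rewrite (@eq_tail _ _ _ _ _ _ A A x (xt t))//; first exact: tail_sub.
  by move=> i Ai; rewrite /xt Ai.
have /cvgrPdist_le/(_ _ e4) hb := uV (xt t).
have /cvgrPdist_le/(_ _ e4) hc := uV (fun=> t).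
near=> n.
have : `|1 - tail V predT (xt t) - (1 - tail Z predT (fun i => u n i (xt t i))) ^+ n| <= e / 4.
  by near: n.
have : `|1 - tail V predT (fun=> t) - (1 - tail Z predT (fun i => u n i t)) ^+ n| <= e / 4.
  by near: n.
set a := 1 - tail Z A _.
pose b := 1 - tail Z predT (fun i => u n i (xt t i)).
(* [c] involves all coordinates, where convergence is assumed, and bounds from below the [c'] that
   enters [expr_gap]. *)
pose c := 1 - tail Z predT (fun i => u n i t).
pose c' := 1 - tail Z (predC A) (fun i => u n i t).
have xtA : tail Z A (fun i => u n i (x i)) = tail Z A (fun i => u n i (xt t i)).
  by apply: eq_tail => // i Ai; rewrite /xt Ai.
have xtC : tail Z (predC A) (fun i => u n i t) = tail Z (predC A) (fun i => u n i (xt t i)).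
  by apply: eq_tail => // i /negbTE Ai; rewrite /xt Ai.
have b0 : 0 <= b by rewrite subr_ge0 tail_le1.
have ba : b <= a by rewrite /a /b xtA lerB// tail_sub.
have a1 : a <= 1 by rewrite gerBl tail_ge0.
have bc : b <= c' by rewrite /b /c' xtC lerB// tail_sub.
have c1 : c' <= 1 by rewrite gerBl tail_ge0.
have cc : c <= c' by rewrite lerB// tail_sub.
have c0 : 0 <= c by rewrite subr_ge0 tail_le1.
have abc : a - b <= 1 - c'.
  rewrite /a /b /c' xtA xtC.
  have := @tail_predU _ _ _ _ _ Z A (predC A) (fun i => u n i (xt t i)).
  have -> : tail Z (predU A (predC A)) (fun i => u n i (xt t i)) =
            tail Z predT (fun i => u n i (xt t i)).
    by apply: eq_tail => // i /=; rewrite orbN.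
  lra.
have gap := @expr_gap _ n _ _ _ b0 ba a1 bc c1 abc.
have cn : c ^+ n <= c' ^+ n by rewrite lerXn2r// nnegrE (le_trans c0).
have bn : b ^+ n <= a ^+ n by rewrite lerXn2r// nnegrE (le_trans b0).
rewrite -/b -/c !ler_norml => /andP[h1 h2] /andP[h3 h4].
apply/andP; split; lra.
Unshelve. all: by end_near. Qed.

End attraction.

(** * Margins of max-stable laws *)


Section limit_law.
Context (R : realType) (I : finType).
Context (dspV : measure_display) (TV : measurableType dspV)
  (PV : probability TV R) (V : I -> {RV PV >-> R}).

Definition max_stable_tail : Prop := forall n : nat, (0 < n)%N ->
  exists a b : I -> R, (forall i, 0 < a i) /\
    forall x, (1 - tail V predT (fun i => a i * x i + b i)) ^+ n
              = 1 - tail V predT x.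

Hypothesis stableV : max_stable_tail.
Hypothesis nondegV : forall i, exists r, 0 < tail1 V i r < 1.

(** The coordinates outside [A] tend to +oo in the stability equation; the same constants serve
    every [A]. *)
Lemma max_stable_margins (n : nat) : (0 < n)%N ->
  exists a b : I -> R, (forall i, 0 < a i) /\
    forall A x, (1 - tail V A (fun i => a i * x i + b i)) ^+ n
                = 1 - tail V A x.
Proof.
move=> n0; have [a [b [a0 ab]]] := stableV n0.
exists a, b; split => // A x.
have idy : (t : R) @[t --> +oo] --> +oo by exact: cvg_id.
have aby i : a i * t + b i @[t --> +oo] --> +oo.
  apply/cvgryPge => M; near=> t.
  have : (M - b i) / a i <= t by near: t; apply: nbhs_pinfty_ge; rewrite num_real.
  by rewrite ler_pdivrMr// mulrC; lra.
have h1 := tail_cvg_margin (X := V) (A := A) (z := fun i => a i * x i + b i)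
   (s := fun t i => a i * t + b i) (fun i _ => aby i).
have h2 := tail_cvg_margin (X := V) (A := A) (z := x) (s := fun t _ => t) (fun i _ => idy).
have {}h1 : (1 - tail V predT (fun i => if A i then a i * x i + b i else a i * t + b i)) ^+ n
    @[t --> +oo] --> (1 - tail V A (fun i => a i * x i + b i)) ^+ n.
  apply: (cvg_comp _ (fun z : R => z ^+ n) _ (@exprn_continuous _ n _)).
  by apply: cvgB h1; exact: cvg_cst.
have {}h2 : 1 - tail V predT (fun i => if A i then x i else t) @[t --> +oo]
    --> 1 - tail V A x.
  by apply: cvgB h2; exact: cvg_cst.
apply: cvg_unique h1 _ => //.
apply: cvg_trans h2; apply: near_eq_cvg; near=> t.
rewrite /= -ab; congr ((_ - _) ^+ _); apply: eq_tail => // i _.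
by case: (A i).
Unshelve. all: by end_near. Qed.

Let G i r := 1 - tail1 V i r.

Lemma max_stable_tail1 (n : nat) : (0 < n)%N ->
  exists a b : I -> R, (forall i, 0 < a i) /\
    forall i r, G i (a i * r + b i) ^+ n = G i r.
Proof.
move=> /max_stable_margins[a [b [a0 ab]]]; exists a, b; split => // i r.
by have := ab (pred1 i) (fun=> r); rewrite !tail_pred1.
Qed.

Lemma margin_01 i r : 0 <= G i r <= 1.
Proof. by rewrite subr_ge0 tail1_le1 gerBl tail1_ge0. Qed.

(* Max-stability turns a value v of the margin into all its rational powers,
   which are dense in the unit interval. *)
Lemma margin_dense i (lo hi : R) : 0 <= lo -> lo < hi -> hi <= 1 ->
  exists r, lo < G i r < hi.
Proof.
(* The logarithm of [lo] will be taken; if [lo] is 0, [hi / 2] replaces it. *)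
move=> lo0; wlog {lo0} lo0 : lo / 0 < lo => [H|] lohi hi1.
  move: lo0; rewrite le_eqVlt => /orP[/eqP lo0|lo0]; last exact: H.
  have [||//|r /andP[r1 r2]] := H (hi / 2); [lra|lra|].
  by exists r; apply/andP; split; lra.
have [r0 r01] := nondegV i.
have hi0 : 0 < hi by lra.
have g01 : 0 < G i r0 < 1 by rewrite /G; lra.
pose c := - ln (G i r0).
have c0 : 0 < c by rewrite oppr_gt0 ln_lt0.
pose al := - ln hi; pose be := - ln lo.
have al0 : 0 <= al by rewrite oppr_ge0 ln_le0.
have albe : al < be by rewrite ltrN2 ltr_ln.
(* In logarithmic scale the target interval, enlarged [n] times, is longer than [c] and so contains
   a multiple of [c]. *)
have [n n0 nc] : exists2 n : nat, (0 < n)%N & c < n%:R * (be - al).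
  exists (Num.trunc (c / (be - al))).+1 => //.
  by rewrite -ltr_pdivrMr ?subr_gt0// truncnS_gt.
have nR0 : 0 < n%:R :> R by rewrite ltr0n.
have [m m0 [am bm]] : exists2 m : nat, (0 < m)%N &
    al * n%:R < m%:R * c /\ m%:R * c < be * n%:R.
  have /truncn_itv : 0 <= al * n%:R / c by rewrite divr_ge0// ?mulr_ge0// ltW.
  rewrite ler_pdivlMr// ltr_pdivrMr// => /andP[m1 m2].
  by exists (Num.trunc (al * n%:R / c)).+1 => //; split => //; rewrite -natr1; lra.
have [a [b [a0 ab]]] := max_stable_tail1 n0.
have [a' [b' [a0' ab']]] := max_stable_tail1 m0.
have /andP[v0 _] := g01.
(* Stability of order [m] gives at [r1] the [m]-th power of the value at [r0]; stability of order
   [n] then extracts an [n]-th root. *)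
pose r1 := (r0 - b' i) / a' i.
have r1E : G i r1 = G i r0 ^+ m.
  by rewrite -ab' /r1 mulrC divfK ?gt_eqF// subrK.
exists (a i * r1 + b i); set g := G i _.
have gn : g ^+ n = G i r0 ^+ m by rewrite -r1E -ab.
have g0 : 0 < g.
  have /andP[+ _] := margin_01 i (a i * r1 + b i).
  rewrite -/g le_eqVlt => /orP[/eqP g0|//].
  have : 0 < g ^+ n by rewrite gn exprn_gt0.
  by rewrite -g0 expr0n gtn_eqF// ltxx.
have lng : - ln g * n%:R = m%:R * c.
  have := congr1 (@ln R) gn; rewrite !lnXn//.
  by rewrite -[LHS]mulr_natr -[RHS]mulr_natl /c mulNr => ->; rewrite mulrN.
rewrite -(ltr_ln) ?posrE// -[g < hi]ltr_ln ?posrE//.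
move: am bm; rewrite -lng !ltr_pM2r// => h1 h2.
by apply/andP; split; rewrite -ltrN2.
Qed.

(** A monotone function with values dense in the unit interval has no jump, so the supremum of the
    points of value at most [c] has value [c]. *)
Lemma margin_quantile i (c : R) : 0 < c < 1 -> exists r, G i r = c.
Proof.
move=> /andP[c0 c1].
have mono r s : G i r < G i s -> r < s.
  by move=> rs; rewrite ltNge; apply/negP => /(tail1_le V i); move: rs; rewrite /G; lra.
pose S := [set r | G i r <= c].
have [r0 /andP[r00 r01]] := margin_dense i (lexx 0) c0 (ltW c1).
have [r1 /andP[r10 r11]] := margin_dense i (ltW c0) c1 (lexx 1).
have supS : has_sup S.
  split; first by exists r0; exact: ltW.
  by exists r1 => r rc; apply/ltW/mono; exact: le_lt_trans r10.
exists (sup S); apply/eqP; rewrite eq_le; apply/andP; split; rewrite leNgt; apply/negP => h.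
  have /andP[_ G1] := margin_01 i (sup S).
  have [r /andP[h1 h2]] := margin_dense i (ltW c0) h G1.
  have [s Ss rs] := sup_gt (ex_intro _ r0 (ltW r01 : S r0)) (mono _ _ h2).
  have : s < r by apply: mono; exact: le_lt_trans Ss h1.
  by rewrite ltNge (ltW rs).
have /andP[G0 _] := margin_01 i (sup S).
have [r /andP[h1 h2]] := margin_dense i G0 h (ltW c1).
have := sup_ubound supS.2 (ltW h2 : S r).
by rewrite leNgt mono.
Qed.

(** Max-stability writes the joint probability as an [n]-th power at a moved point, where each
    marginal exceedance is at most the original - ln divided by [n]. For large [n] these sum to less
    than 1, and the union bound concludes. *)
Lemma tail_lt1 (A : pred I) (y : I -> R) :
  (forall i, A i -> 0 < G i (y i)) -> tail V A y < 1.
Proof.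
move=> y0; pose s := \sum_(i | A i) - ln (G i (y i)).
have [n n0 sn] : exists2 n : nat, (0 < n)%N & s < n%:R.
  by exists (Num.trunc s).+1 => //; exact: truncnS_gt.
have [a [b [a0 ab]]] := max_stable_margins n0.
rewrite -subr_gt0 -ab exprn_gt0// subr_gt0.
apply: le_lt_trans (tail_le_sum V A _) _.
apply: (@le_lt_trans _ _ (\sum_(i | A i) - ln (G i (y i)) / n%:R)).
  apply: ler_sum => i Ai; rewrite ler_pdivlMr ?ltr0n//.
  have gn : G i (a i * y i + b i) ^+ n = G i (y i).
    by have := ab (pred1 i) y; rewrite !tail_pred1.
  have g0 : 0 < G i (a i * y i + b i).
    have /andP[+ _] := margin_01 i (a i * y i + b i).
    rewrite le_eqVlt => /orP[/eqP g0|//].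
    by have := y0 _ Ai; rewrite -gn -g0 expr0n gtn_eqF// ltxx.
  rewrite -gn lnXn// -[in leRHS]mulr_natr -mulNr ler_pM2r ?ltr0n//.
  have := ln_le_sub1 g0; rewrite /G; lra.
by rewrite -mulr_suml ltr_pdivrMr ?ltr0n// mul1r.
Qed.

End limit_law.

(** * Limits of excess probabilities *)


Section excess.
Context (R : realType) (dsp : measure_display) (T : measurableType dsp)
  (P : probability T R) (I : finType) (Z : I -> {RV P >-> R}).
Implicit Types (A : pred I) (x : I -> R).

(* Since 1 - F_i(Z_i) = tail1 Z i (Z_i), this is the event F_i(Z_i) > 1 - s. *)
Definition rank_excess (i : I) (s : R) : set T :=
  [set w | tail1 Z i (Z i w) < s].

Definition excess A x (t : R) : R :=
  t^-1 * prob P (union_over A (fun i => rank_excess i (t * x i))).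

Lemma measurable_rank_excess i s : measurable (rank_excess i s).
Proof.
rewrite (_ : rank_excess i s = (tail1 Z i \o Z i) @^-1` `]-oo, s[); last first.
  by apply/seteqP; split => w /=; rewrite in_itv.
rewrite -[X in measurable X]setTI; apply: measurableT_comp => //.
apply: nonincreasing_measurable => // r r'; exact: tail1_le.
Qed.

Lemma measurable_union_excess A x t :
  measurable (union_over A (fun i => rank_excess i (t * x i))).
Proof. by apply: measurable_union_over => i; exact: measurable_rank_excess. Qed.

Lemma sub_rank_excess i s s' : s <= s' -> rank_excess i s `<=` rank_excess i s'.
Proof. by move=> ss w; rewrite /rank_excess/= => /lt_le_trans; exact. Qed.

Lemma rank_excess_le0 i s : s <= 0 -> rank_excess i s = set0.
Proof.
move=> s0; rewrite -subset0 => w; rewrite /rank_excess/= => h.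
by have := lt_le_trans h s0; rewrite ltNge tail1_ge0.
Qed.

End excess.

Section domain_of_attraction.
Context (R : realType) (I : finType).
Context (dspZ : measure_display) (TZ : measurableType dspZ)
  (PZ : probability TZ R) (Z : I -> {RV PZ >-> R}).
Context (dspV : measure_display) (TV : measurableType dspV)
  (PV : probability TV R) (V : I -> {RV PV >-> R}).
Hypothesis stableV : max_stable_tail V.
Hypothesis nondegV : forall i, exists r, 0 < tail1 V i r < 1.
Hypothesis ZV : attracted Z V.

Let G i r := 1 - tail1 V i r.

(** The joint tail varies by at most the sum of the marginal variations, and [tail_lt1] puts the
    logarithm at a positive value. Closeness is measured on marginal values because density controls
    these; comparability of the points is what [tail_increment] handles. *)
Lemma continuity_log_tail (A : pred I) (y : I -> R) (e : R) :
  (forall i, A i -> 0 < G i (y i)) -> 0 < e ->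
  exists2 del : R, 0 < del & forall z : I -> R,
    (forall i, A i -> y i <= z i) \/ (forall i, A i -> z i <= y i) ->
    (forall i, A i -> `|G i (y i) - G i (z i)| < del) ->
    `|- ln (1 - tail V A y) - - ln (1 - tail V A z)| < e.
Proof.
move=> Gy e0.
have p0 : 0 < 1 - tail V A y by rewrite subr_gt0; exact: tail_lt1.
have /cvgrPdist_lt/(_ _ e0) := continuous_ln p0.
move=> /nbhs_ballP[eta eta0 hball].
(* One more than the number of coordinates, so that the sum stays strictly below [eta]. *)
pose N := (#|I|.+1)%:R : R.
have N0 : 0 < N by rewrite ltr0n.
exists (eta / N) => [|z yz Gz]; first by rewrite divr_gt0.
have bd (y1 y2 : I -> R) : (forall i, A i -> y1 i <= y2 i) ->
    (forall i, A i -> `|G i (y1 i) - G i (y2 i)| < eta / N) ->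
    0 <= tail V A y1 - tail V A y2 < eta.
  move=> y12 G12; rewrite subr_ge0 tail_le//=.
  apply: (le_lt_trans (tail_increment V y12)).
  apply: (@le_lt_trans _ _ (\sum_(i | A i) (eta / N))).
    apply: ler_sum => i /G12; rewrite /G => /ltW; rewrite ler_norml.
    move: (eta / N) => q; lra.
  rewrite sumr_const -mulr_natr -mulrA gtr_pMr// ltr_pdivrMl// mulr1 ltr_nat ltnS.
  exact: max_card.
have : `|ln (1 - tail V A y) - ln (1 - tail V A z)| < e.
  apply: hball; rewrite /ball/=.
  have [/bd|/bd] := yz.
    by move=> /(_ Gz) h; rewrite ltr_norml; lra.
  have Gz' i : A i -> `|G i (z i) - G i (y i)| < eta / N.
    by move=> /Gz; rewrite distrC.
  by move=> /(_ Gz') h; rewrite ltr_norml; lra.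
by rewrite -opprD normrN.
Qed.

Lemma choose_margins (A : pred I) (lo hi : I -> R) :
  (forall i, A i -> [&& 0 <= lo i, lo i < hi i & hi i <= 1]) ->
  exists z : I -> R, forall i, A i -> lo i < G i (z i) < hi i.
Proof.
move=> lohi; suff /choice[z zP] : forall i, exists r, A i -> lo i < G i r < hi i.
  by exists z.
move=> i.
case: (boolP (A i)) => [/lohi/and3P[lo0 lt hi1]|nA]; last by exists 0.
by have [r ?] := margin_dense stableV nondegV i lo0 lt hi1; exists r.
Qed.

Lemma margin_lt i r r' : G i r < G i r' -> r < r'.
Proof.
move=> rr; rewrite ltNge; apply/negP => /(tail1_le V i); move: rr; rewrite /G; lra.
Qed.

(* With n = trunc (1 / t), the event F_i(Z_i) > 1 - t x_i is contained in
   Z_i > u n i (z i) if G i (z i) is slightly smaller than G i (y i), and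
   contains Z_i > u n.+1 i (z' i) if G i (z' i) is slightly larger. *)
Lemma excess_cvg_interior (A : pred I) (y : I -> R) :
  (forall i, A i -> 0 < G i (y i) < 1) ->
  excess Z A (fun i => - ln (G i (y i))) t @[t --> 0^'+]
    --> - ln (1 - tail V A y).
Proof.
move=> Gy; have [u uZ] := ZV; have uA := attracted_margin uZ.
set x := fun i => - ln (G i (y i)).
set L := - ln (1 - tail V A y).
apply/cvgrPdist_lt => e e0.
have e2 : 0 < e / 2 by rewrite divr_gt0.
have [|del del0 hdel] := @continuity_log_tail A y (e / 2) _ e2.
  by move=> i /Gy/andP[].
(* Truncation at 0, and at 1 for [z'], keeps the target interval inside [0, 1]. *)
have [z zA] : exists z : I -> R, forall i, A i ->
    Num.max 0 (G i (y i) - del) < G i (z i) < G i (y i).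
  apply: choose_margins => i /Gy/andP[g0 g1].
  by rewrite le_max lexx gt_max g0 gtrBl del0 (ltW g1).
have [z' zA'] : exists z : I -> R, forall i, A i ->
    G i (y i) < G i (z i) < Num.min 1 (G i (y i) + del).
  apply: choose_margins => i /Gy/andP[g0 g1].
  by rewrite lt_min g1 ltrDl del0 ge_min lexx (ltW g0).
have zL : `|L - - ln (1 - tail V A z)| < e / 2.
  apply: hdel; first by right => i Ai; have /andP[_ /margin_lt/ltW] := zA _ Ai.
  by move=> i /zA; rewrite gt_max ltr_norml; lra.
have zL' : `|L - - ln (1 - tail V A z')| < e / 2.
  apply: hdel; first by left => i Ai; have /andP[/margin_lt/ltW] := zA' _ Ai.
  by move=> i /zA'; rewrite lt_min ltr_norml; lra.
have Gz i : A i -> 0 < G i (z i) by move=> /zA; rewrite gt_max; lra.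
have Gz' i : A i -> 0 < G i (z' i).
  by move=> Ai; have := zA' _ Ai; have := Gy _ Ai; lra.
have tail01 B w n : 0 <= 1 - tail Z B (fun i => u n i (w i)) <= 1.
  by rewrite subr_ge0 tail_le1 gerBl tail_ge0.
have lim1 B w : tail V B w < 1 ->
    tail Z B (fun i => u n i (w i)) @[n --> \oo] --> 0 /\
    n%:R * tail Z B (fun i => u n i (w i)) @[n --> \oo] --> - ln (1 - tail V B w).
  rewrite -subr_gt0 => h; have := cvg_expr_ln h (tail01 B w) (uA B w).
  under [X in X @ _ --> _]eq_fun do rewrite opprB addrC subrK.
  by under [X in _ /\ X @ _ --> _]eq_fun do rewrite opprB addrC subrK.
have gt0x i : A i -> 0 < x i by move=> /Gy h; rewrite oppr_gt0 ln_lt0.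
have [a0 aL] := lim1 _ _ (tail_lt1 stableV Gz).
have [a0' aL'] := lim1 _ _ (tail_lt1 stableV Gz').
(* As 1 / t lies between n and n + 1, the upper bound pairs n + 1 with [u n] and the lower bound
   pairs n with [u n.+1]; the shift vanishes in the limit since the tails tend to 0. *)
have upper : n.+1%:R * tail Z A (fun i => u n i (z i)) @[n --> \oo]
    --> - ln (1 - tail V A z).
  rewrite -[X in _ --> X]addr0.
  by under eq_fun do rewrite -natr1 mulrDl mul1r; exact: cvgD.
have lower : n%:R * tail Z A (fun i => u n.+1 i (z' i)) @[n --> \oo]
    --> - ln (1 - tail V A z').
  move: aL' a0'; rewrite -cvg_shiftS => aL'; rewrite -cvg_shiftS => a0'.
  rewrite -[X in _ --> X]subr0.
  under eq_fun => n do rewrite -[n%:R](addrK 1) natr1 mulrBl mul1r.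
  exact: cvgB.
have upper1 : \forall n \near \oo, forall i, A i ->
    x i < n%:R * tail1 Z i (u n i (z i)).
  apply: filter_forall => i; case: (boolP (A i)) => [Ai|nA]; last by near=> n.
  have zi : tail V (pred1 i) z < 1.
    by rewrite tail_pred1; have := Gz _ Ai; rewrite /G; lra.
  have [_] := lim1 _ _ zi; rewrite !tail_pred1 => /cvgr_gt/(_ (x i)) h.
  have /h : x i < - ln (1 - tail1 V i (z i)).
    by rewrite /x ltrN2 ltr_ln ?posrE; have := zA _ Ai; have := Gz _ Ai; have := Gy _ Ai; rewrite /G; lra.
  by apply: filterS => n /= + _; rewrite tail_pred1.
have lower1 : \forall n \near \oo, forall i, A i ->
    n.+1%:R * tail1 Z i (u n.+1 i (z' i)) < x i.
  apply: filter_forall => i; case: (boolP (A i)) => [Ai|nA]; last by near=> n.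
  have zi : tail V (pred1 i) z' < 1.
    by rewrite tail_pred1; have := Gz' _ Ai; rewrite /G; lra.
  have [_] := lim1 _ _ zi; rewrite !tail_pred1 -cvg_shiftS => /cvgr_lt/(_ (x i)) h.
  have /h : - ln (1 - tail1 V i (z' i)) < x i.
    by rewrite /x ltrN2 ltr_ln ?posrE; have := zA' _ Ai; have := Gz' _ Ai; have := Gy _ Ai; rewrite /G; lra.
  by apply: filterS => n /= + _; rewrite tail_pred1.
move/cvgrPdist_lt : upper => /(_ _ e2) upper.
move/cvgrPdist_lt : lower => /(_ _ e2) lower.
have [N _ HN] := filterI (filterI upper upper1) (filterI lower lower1).
near=> t.
have t0 : 0 < t by near: t; exact: nbhs_right_gt.
have tN : t < N.+1%:R^-1 by near: t; apply: nbhs_right_lt; rewrite invr_gt0.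
have tV0 : 0 <= t^-1 by rewrite invr_ge0 ltW.
have [n Nn [nt tn]] : exists2 n, (N < n)%N & n%:R <= t^-1 /\ t^-1 < n.+1%:R.
  have /andP[h1 h2] := truncn_itv tV0; exists (Num.trunc t^-1) => //.
  rewrite -ltnS -(ltr_nat R); apply: le_lt_trans h2.
  by rewrite -[leLHS]invrK lef_pV2 ?posrE// ltW.
have [[up up1] [lo lo1]] := HN n (ltnW Nn).
have n0 : 0 < n%:R :> R by rewrite ltr0n (leq_ltn_trans _ Nn).
have nt1 : n%:R * t <= 1 by rewrite -ler_pdivlMr// mul1r.
have nt2 : 1 < n.+1%:R * t by rewrite -ltr_pdivrMr// mul1r.
have mex := measurable_union_excess Z A x t.
have upE : excess Z A x t <= n.+1%:R * tail Z A (fun i => u n i (z i)).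
  apply: (@le_trans _ _ (t^-1 * tail Z A (fun i => u n i (z i)))).
    apply: ler_wpM2l => //; apply: le_prob => //; first exact: measurable_tail.
    (* If [Z i] were at most [u n i (z i)], its exceedance probability would be at least that of
       [u n i (z i)], hence more than x_i / n >= t x_i. *)
    move=> w [i [Ai wi]]; exists i; split => //=; rewrite ltNge; apply/negP.
    move=> /(tail1_le Z i); apply/negP; rewrite -ltNge; apply: (lt_le_trans wi).
    rewrite -(ler_pM2l n0) mulrA; apply: (le_trans _ (ltW (up1 i Ai))).
    by rewrite ler_piMl// ltW// gt0x.
  by apply: ler_wpM2r; rewrite ?tail_ge0// ltW.
have loE : n%:R * tail Z A (fun i => u n.+1 i (z' i)) <= excess Z A x t.
  apply: (@le_trans _ _ (t^-1 * tail Z A (fun i => u n.+1 i (z' i)))).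
    by apply: ler_wpM2r; rewrite ?tail_ge0.
  apply: ler_wpM2l => //; apply: le_prob => //; first exact: measurable_tail.
  move=> w [i [Ai wi]]; exists i; split => //=.
  apply: (le_lt_trans (tail1_le Z i (ltW wi))).
  have n1 : 0 < n.+1%:R :> R by [].
  rewrite -(ltr_pM2l n1) mulrA; apply: (lt_trans (lo1 i Ai)).
  by rewrite ltr_pMl// gt0x.
move: up lo zL zL' upE loE; rewrite !ltr_norml.
move: (n.+1%:R * _) (n%:R * _) (excess _ _ _ _) (ln (1 - tail V A z)) (ln (1 - tail V A z')).
move=> q1 q2 q3 q4 q5; lra.
Unshelve. all: by end_near. Qed.

(** A coordinate of marginal value 1 has level 0: its excess event is empty and its tail null.
    Dropping such coordinates leaves the interior case. *)
Lemma excess_cvg (A : pred I) (y : I -> R) :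
  (forall i, A i -> 0 < G i (y i)) ->
  excess Z A (fun i => - ln (G i (y i))) t @[t --> 0^'+]
    --> - ln (1 - tail V A y).
Proof.
move=> Gy; pose B i := A i && (G i (y i) < 1).
have -> : tail V A y = tail V B y.
  apply/eqP; rewrite eq_le; apply/andP; split; last first.
    by apply: tail_sub => i /andP[].
  pose C i := A i && ~~ (G i (y i) < 1).
  have -> : tail V A y = tail V (predU B C) y.
    by apply: eq_tail => // i /=; rewrite /B /C -andb_orr orbN andbT.
  apply: (le_trans (tail_predU _ _ _ _)); rewrite gerDl.
  apply: (le_trans (tail_le_sum _ _ _)); apply: sumr_le0 => i /andP[_].
  by rewrite -leNgt /G; lra.
have -> : excess Z A (fun i => - ln (G i (y i))) = excess Z B (fun i => - ln (G i (y i))).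
  apply/funext => t; congr (_ * prob _ _); apply/seteqP; split => w [i [Ai wi]]; exists i; split => //.
    apply/andP; split => //; rewrite ltNge; apply/negP => G1.
    have : G i (y i) = 1 by apply/eqP; rewrite eq_le G1 gerBl tail1_ge0.
    by move=> G1'; move: wi; rewrite G1' ln1 oppr0 mulr0 rank_excess_le0.
  by case/andP : Ai.
by apply: excess_cvg_interior => i /andP[/Gy ->].
Qed.

End domain_of_attraction.

(** * Partitions of the coordinates *)


Lemma at_right0_scale (R : realType) (M : R) : 0 < M ->
  (M * t : R) @[t --> 0^'+] --> (0 : R)^'+.
Proof.
move=> M0 Q; rewrite /at_right !nbhs_simpl/= => /nbhs_ballP[d /= d0 dQ].
apply/nbhs_ballP; exists (d / M) => /=; first by rewrite divr_gt0.
move=> t /=; rewrite /ball/= !sub0r !normrN => td t0; apply: dQ.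
  by rewrite /ball/= sub0r normrN normrM gtr0_norm// mulrC -ltr_pdivlMr.
exact: mulr_gt0.
Qed.

Lemma ln_prod (R : realType) (J : finType) (f : J -> R) : (forall k, 0 < f k) ->
  ln (\prod_k f k) = \sum_k ln (f k).
Proof.
move=> f0; suff [] : 0 < \prod_k f k /\ ln (\prod_k f k) = \sum_k ln (f k) by [].
apply: (big_ind2 (fun a b : R => 0 < a /\ ln a = b)) => //; first by rewrite ln1.
by move=> a _ b _ [a0 <-] [b0 <-]; rewrite mulr_gt0// lnM.
Qed.

Section excess_gap.
Context (R : realType) (dsp : measure_display) (T : measurableType dsp)
  (P : probability T R) (I J : finType) (Z : I -> {RV P >-> R}) (c : I -> J).
Implicit Types (x y : I -> R).

(** The defect of the union bound. The partition is the family of fibres of a labelling [c], which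
    covers both the [d] blocks and the two classes old and new. *)
Definition excess_gap x (t : R) : R :=
  \sum_k excess Z [pred i | c i == k] x t - excess Z predT x t.

(** [union_increment] for the class events: their union grows by no more than the sum of their
    probabilities. *)
Lemma excess_gap_le x y t : 0 < t -> (forall i, x i <= y i) ->
  excess_gap x t <= excess_gap y t.
Proof.
move=> t0 xy.
have tV0 : 0 <= t^-1 by rewrite invr_ge0 ltW.
pose B z k := union_over [pred i | c i == k] (fun i => rank_excess Z i (t * z i)).
have BE z : union_over predT (fun i => rank_excess Z i (t * z i)) = union_over predT (B z).
  apply/seteqP; split => w; first by move=> [i [_ ?]]; exists (c i); split => //; exists i; split => //=.
  by move=> [k [_ [i [_ ?]]]]; exists i.
have mB z k : measurable (B z k) by exact: measurable_union_excess.
rewrite /excess_gap /excess !BE -!mulr_sumr -!mulrBr ler_wpM2l//.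
have := @union_increment _ _ _ P J predT (B x) (B y) (mB x) (mB y).
rewrite sumrB => h; rewrite lerBlDr; suff : forall a b a' b' : R, b - a <= b' - a' -> a' <= b' - b + a.
  by apply; apply: h => k _ w [i [ik wi]]; exists i; split => //;
     apply: sub_rank_excess wi; rewrite ler_pM2l.
by move=> a b a' b'; lra.
Qed.

Lemma excess0 A t : excess Z A (fun=> 0) t = 0.
Proof.
rewrite /excess (_ : union_over _ _ = set0); first by rewrite /prob measure0 mulr0.
by rewrite -subset0 => w [i [_]]; rewrite mulr0 rank_excess_le0.
Qed.

Lemma excess_gap_ge0 x t : 0 < t -> (forall i, 0 <= x i) -> 0 <= excess_gap x t.
Proof.
move=> t0 x0; have := excess_gap_le t0 x0.
by rewrite {1}/excess_gap excess0 big1 ?subrr// => k _; rewrite excess0.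
Qed.

(** Homogeneity holds before the limit, by substituting [M * t] for [t]. *)
Lemma excess_scale A (M t : R) : M != 0 ->
  excess Z A (fun=> M) t = M * excess Z A (fun=> 1) (M * t).
Proof.
move=> M0; rewrite /excess invfM mulrA mulrA mulfV// mul1r.
by rewrite mulr1 (mulrC M).
Qed.

Lemma excess_gap_scale (M t : R) : M != 0 ->
  excess_gap (fun=> M) t = M * excess_gap (fun=> 1) (M * t).
Proof.
move=> M0; rewrite /excess_gap mulrBr mulr_sumr excess_scale//.
by congr (_ - _); apply: eq_bigr => k _; exact: excess_scale.
Qed.

End excess_gap.

(** * Extremal coefficients of sets of coordinates *)

Section extremal_coefficients.
Context (R : realType) (I : finType).
Context (dspZ : measure_display) (TZ : measurableType dspZ)
  (PZ : probability TZ R) (Z : I -> {RV PZ >-> R}).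
Context (dspV : measure_display) (TV : measurableType dspV)
  (PV : probability TV R) (V : I -> {RV PV >-> R}).
Hypothesis stableV : max_stable_tail V.
Hypothesis nondegV : forall i, exists r, 0 < tail1 V i r < 1.
Hypothesis ZV : attracted Z V.

Definition extremal_coefficient (A : pred I) : R :=
  lim (excess Z A (fun=> 1) t @[t --> 0^'+]).

(** The point where each marginal - ln is exactly 1, so that the level vector is constant 1; this
    takes quantiles, not just density. *)
Lemma unit_point : exists y : I -> R, forall i, 1 - tail1 V i (y i) = expR (- 1).
Proof.
suff /choice[y yE] : forall i, exists r, 1 - tail1 V i r = expR (- 1) by exists y.
move=> i; apply: margin_quantile => //.
by rewrite expR_gt0 expR_lt1 ltrN10.
Qed.

Lemma excess1_cvg (y : I -> R) : (forall i, 1 - tail1 V i (y i) = expR (- 1)) ->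
  forall A, excess Z A (fun=> 1) t @[t --> 0^'+] --> - ln (1 - tail V A y).
Proof.
move=> yE A.
rewrite (_ : (fun=> 1) = (fun i => - ln (1 - tail1 V i (y i)))); last first.
  by apply/funext => i; rewrite yE expRK opprK.
by apply: excess_cvg => // i _; rewrite yE expR_gt0.
Qed.

Lemma is_cvg_excess1 A : cvg (excess Z A (fun=> 1) t @[t --> 0^'+]).
Proof.
by have [y /excess1_cvg/(_ A) h] := unit_point; apply/cvg_ex; eexists; exact: h.
Qed.

Lemma coefficientE (y : I -> R) : (forall i, 1 - tail1 V i (y i) = expR (- 1)) ->
  forall A, extremal_coefficient A = - ln (1 - tail V A y).
Proof. by move=> yE A; apply/cvg_lim => //; exact: excess1_cvg. Qed.

Lemma tail_unit_lt1 (y : I -> R) : (forall i, 1 - tail1 V i (y i) = expR (- 1)) ->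
  forall A, 0 < 1 - tail V A y.
Proof.
by move=> yE A; rewrite subr_gt0; apply: tail_lt1 => // i _; rewrite yE expR_gt0.
Qed.

Lemma coefficient_sub (A B : pred I) : (forall i, A i -> B i) ->
  extremal_coefficient A <= extremal_coefficient B.
Proof.
move=> AB; have [y yE] := unit_point; rewrite !(coefficientE yE) lerN2.
by rewrite ler_ln ?posrE ?tail_unit_lt1// lerB// tail_sub.
Qed.

Section partition.
Variables (J : finType) (c : I -> J).

Let gap1 : excess_gap Z c (fun=> 1) t @[t --> 0^'+] -->
  \sum_k extremal_coefficient [pred i | c i == k] - extremal_coefficient predT.
Proof.
apply: cvgB; last exact: is_cvg_excess1.
by apply: cvg_big => [|k _]; [exact: add_continuous|exact: is_cvg_excess1].
Qed.

Lemma coefficient_partition_ge :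
  extremal_coefficient predT <= \sum_k extremal_coefficient [pred i | c i == k].
Proof.
rewrite -subr_ge0; apply: (@cvgr_to_ge _ _ _ _ _ _ 0 gap1).
near=> t; apply: excess_gap_ge0 => [|//]; near: t; exact: nbhs_right_gt.
Unshelve. all: by end_near. Qed.

Definition factorizes : Prop := forall y : I -> R,
  1 - tail V predT y = \prod_k (1 - tail V [pred i | c i == k] y).

(* The gap is nondecreasing in x and homogeneous: once it vanishes at 1, it
   vanishes everywhere. *)
Lemma coefficient_partition_eq :
  \sum_k extremal_coefficient [pred i | c i == k] = extremal_coefficient predT <-> factorizes.
Proof.
(* The converse is the factorization at the unit point, read through logarithms. *)
split => [sumE y|fact]; last first.
  have [y yE] := unit_point; rewrite (coefficientE yE) fact.
  rewrite (eq_bigr (fun k => - ln (1 - tail V [pred i | c i == k] y))); last first.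
    by move=> k _; rewrite (coefficientE yE).
  rewrite sumrN; congr (- _); rewrite -ln_prod//.
  by move=> k; exact: (tail_unit_lt1 yE).
(* Where some margin vanishes the level would be infinite, but both sides are 0. *)
have [[i0 yi0]|y0] := pselect (exists i, 1 - tail1 V i (y i) <= 0).
  have t1 (A : pred I) : A i0 -> 1 - tail V A y = 0.
    move=> Ai; apply/eqP; rewrite eq_le subr_ge0 tail_le1 andbT.
    by apply: le_trans yi0; rewrite lerB// tail1_le_tail.
  by rewrite t1// (bigD1 (c i0))//= t1 ?mul0r//=.
have Gy i : 0 < 1 - tail1 V i (y i).
  by rewrite ltNge; apply/negP => ?; apply: y0; exists i.
have pos A : 0 < 1 - tail V A y by rewrite subr_gt0; apply: tail_lt1 => // i _.
pose x i := - ln (1 - tail1 V i (y i)).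
have x0 i : 0 <= x i by rewrite oppr_ge0 ln_le0// gerBl tail1_ge0.
(* The summand 1 keeps [M] positive when all levels are 0. *)
pose M := 1 + \sum_i x i.
have sx0 : 0 <= \sum_i x i by apply: sumr_ge0.
have M0 : 0 < M by rewrite ltr_pwDl.
have xM i : x i <= M.
  rewrite /M (bigD1 i)//= addrCA lerDl addr_ge0//; exact: sumr_ge0.
have gapx0 : excess_gap Z c x t @[t --> 0^'+] --> (0 : R).
  apply: (@squeeze_cvgr _ _ _ _ (fun=> 0) (fun t => M * excess_gap Z c (fun=> 1) (M * t))).
  - near=> t; have t0 : 0 < t by near: t; exact: nbhs_right_gt.
    by rewrite excess_gap_ge0//= -excess_gap_scale ?gt_eqF// excess_gap_le.
  - exact: cvg_cst.
  - rewrite -[X in _ --> X](mulr0 M); apply: cvgM; first exact: cvg_cst.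
    apply: (cvg_comp _ (excess_gap Z c (fun=> 1)) (at_right0_scale M0)).
    by move: gap1; rewrite sumE subrr.
(* The same gap tends to the logarithm of the ratio of the two sides, which is therefore 0. *)
have gapx : excess_gap Z c x t @[t --> 0^'+] -->
    \sum_k - ln (1 - tail V [pred i | c i == k] y) - - ln (1 - tail V predT y).
  apply: cvgB; last exact: excess_cvg.
  apply: cvg_big => [|k _]; [exact: add_continuous|].
  exact: excess_cvg.
have lnE : \sum_k - ln (1 - tail V [pred i | c i == k] y)
    - - ln (1 - tail V predT y) = 0 by exact: cvg_unique gapx gapx0.
move/eqP : lnE; rewrite sumrN opprK -ln_prod// addrC subr_eq0 => /eqP lnE.
by apply: ln_inj; rewrite ?posrE ?prodr_gt0.
Unshelve. all: by end_near. Qed.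

End partition.
End extremal_coefficients.

(** * From blocks to a single index set *)


Section flat_coordinates.
Variables (d : nat) (p : 'I_d -> nat).

(** The disjoint union of the blocks as one finite type: sets of coordinates become predicates, and
    [tag] labels the blocks. *)
Definition coord : finType := {j : 'I_d & 'I_(p j)}.

Definition flatten_blocks (T : Type) (x : blocks p T) (i : coord) : T :=
  x (tag i) (tagged i).

Definition unflatten_blocks (T : Type) (z : coord -> T) : blocks p T :=
  fun j l => z (Tagged (fun i => 'I_(p i)) l).

Lemma unflattenK (T : Type) (z : coord -> T) :
  flatten_blocks (unflatten_blocks z) = z.
Proof. by apply/funext => -[]. Qed.

End flat_coordinates.

(** * Max-domain of attraction in flat coordinates *)

Section domain_of_attraction_blocks.
Context (R : realType) (d : nat) (p : 'I_d -> nat).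
Local Notation I := (coord p).

Section joint_distribution.
Context (dsp : measure_display) (T : measurableType dsp) (P : probability T R).

Lemma joint_cdf_event (Z : blocks p {RV P >-> R}) (x : blocks p R) :
  [set w : T | forall j l, Z j l w <= x j l] =
  ~` union_over predT (fun i => [set w : T | flatten_blocks x i < flatten_blocks Z i w]).
Proof.
apply/seteqP; split => w /= H.
  by move=> [[j l] [_ /=]]; rewrite ltNge /flatten_blocks/= H.
move=> j l; rewrite leNgt; apply/negP => ?.
by apply: H; exists (Tagged (fun i => 'I_(p i)) l).
Qed.

Lemma joint_cdfE (Z : blocks p {RV P >-> R}) (x : blocks p R) :
  joint_cdf Z x = 1 - tail (flatten_blocks Z) predT (flatten_blocks x).
Proof.
by rewrite /joint_cdf joint_cdf_event -[LHS]/(prob P _) prob_setC//; exact: measurable_tail.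
Qed.

End joint_distribution.

Section limit_distribution.
Variable H : blocks p R -> R.
Context (dsp : measure_display) (T : measurableType dsp) (P : probability T R)
  (V : I -> {RV P >-> R}).
Hypothesis HV : forall x, H x = 1 - tail V predT (flatten_blocks x).

Lemma marginE (A : forall j : 'I_d, 'I_(p j) -> bool) (x : blocks p R) :
  margin H A x = 1 - tail V (fun i => A (tag i) (tagged i)) (flatten_blocks x).
Proof.
apply/cvg_lim => //; under eq_fun do rewrite HV.
apply: cvgB; first exact: cvg_cst.
apply: (@tail_cvg_margin _ _ _ _ _ V (fun i => A (tag i) (tagged i)) (flatten_blocks x) (fun t _ => t)).
by move=> i _; exact: cvg_id.
Qed.

Lemma max_stable_flat : max_stable H -> max_stable_tail V.
Proof.
move=> Hms n /Hms[a [b [a0 ab]]]; exists (flatten_blocks a), (flatten_blocks b).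
split => [i|x]; first exact: a0.
rewrite -(unflattenK x); move: (unflatten_blocks x) => z.
by have := ab z; rewrite !HV.
Qed.

Lemma nondegenerate_flat : nondegenerate_margins H ->
  forall i, exists r, 0 < tail1 V i r < 1.
Proof.
move=> Hnd [j l]; have [x] := Hnd j l; rewrite marginE.
rewrite (_ : tail V _ _ = tail1 V (Tagged (fun i => 'I_(p i)) l) (x j l)).
  by move=> h; exists (x j l); move: h => /andP[]; lra.
pose i0 : I := Tagged (fun i => 'I_(p i)) l.
by rewrite -[x j l]/(flatten_blocks x i0) -tail_pred1; apply: eq_tail => // -[].
Qed.

End limit_distribution.

(** The maximum is below [y] when every copy is, and these events are independent. For [n] = 0 the
    initial value would still constrain copy 0. *)
Lemma copies_max_cdf (dsp : measure_display) (T : measurableType dsp)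
    (P : probability T R) (Z : blocks p {RV P >-> R})
    (dsp' : measure_display) (T' : measurableType dsp') (P' : probability T' R)
    (Y : nat -> blocks p {RV P' >-> R}) (n : nat) (y : blocks p R) :
  iid_copies Z Y -> (0 < n)%N ->
  fine (P' [set w | forall j l, copies_max Y n l w <= y j l]) = joint_cdf Z y ^+ n.
Proof.
move=> [YZ indY] n0.
pose A i := [set w : T' | forall j l, Y i j l w <= y j l].
have AE : [set w : T' | forall j l, copies_max Y n l w <= y j l] =
    \bigcap_(i in [set i | (i < n)%N]) A i.
  apply/seteqP; split => w /= h.
    by move=> i /= iln j l; have /bigmax_leP[_ /(_ (Ordinal iln) isT)] := h j l.
  by move=> j l; apply/bigmax_leP; split => [|i _]; [exact: h n0 _ _|exact: h (ltn_ord i) _ _].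
rewrite AE indY.
  under eq_bigr => i _ do rewrite -[fine _]/(joint_cdf (Y i) y) YZ.
  by rewrite prodr_const card_ord.
(* The event is a finite intersection of generators, one for each flat coordinate. *)
move=> i iln; rewrite /sigma_generated.
set G := [set A | _].
have -> : A i = \bigcap_(k in [set: I])
    (Y i (tag k) (tagged k) @^-1` `]-oo, flatten_blocks y k]).
  apply/seteqP; split => w h.
    by move=> k _; rewrite /= in_itv/=; exact: h.
  by move=> j l; have := h (Tagged (fun i => 'I_(p i)) l) Logic.I; rewrite /= in_itv.
apply: (@fin_bigcap_measurable _ (g_sigma_algebraType G)) => //.
move=> k _; apply: sub_sigma_algebra; exists (tag k), (tagged k).
by exists `]-oo, flatten_blocks y k]%classic.
Qed.

(** [V] is a vector with law [H], supplied by [is_df]. Later lemmas use the domain of attraction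
    only through these four facts. *)
Lemma in_mda_flat (dsp : measure_display) (T : measurableType dsp)
    (P : probability T R) (Z : blocks p {RV P >-> R}) (H : blocks p R -> R) :
  in_mda Z H ->
  exists (dspV : measure_display) (TV : measurableType dspV)
    (PV : probability TV R) (V : I -> {RV PV >-> R}),
    [/\ forall x, H x = 1 - tail V predT (flatten_blocks x),
        max_stable_tail V,
        forall i, exists r, 0 < tail1 V i r < 1 &
        attracted (flatten_blocks Z) V].
Proof.
move=> [[[dspV [TV [PV [V HV]]]] Hnd Hms]].
move=> [dsp' [T' [P' [Y [u [iidY _ uH]]]]]].
have HV' x : H x = 1 - tail (flatten_blocks V) predT (flatten_blocks x).
  by rewrite HV joint_cdfE.
exists dspV, TV, PV, (flatten_blocks V); split => //.
- exact: max_stable_flat HV' Hms.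
- exact: nondegenerate_flat HV' Hnd.
exists (fun n i => u n (tag i) (tagged i)) => x.
have := uH (unflatten_blocks x); rewrite HV' unflattenK; apply: cvg_trans.
apply: near_eq_cvg; near=> n.
have n0 : (0 < n)%N by near: n; exact: nbhs_infty_gt.
rewrite (copies_max_cdf (fun j l => u n j l (unflatten_blocks x l)) iidY n0) joint_cdfE.
congr ((1 - _) ^+ _); apply: eq_tail => // -[j l] _ //.
Unshelve. all: by end_near. Qed.

End domain_of_attraction_blocks.

(** * SECO as a functional of the copula *)


Section block_events.
Context (R : realType) (dsp : measure_display) (T : measurableType dsp)
  (P : probability T R).

Definition block_exceeds (m : nat) (X : 'I_m -> {RV P >-> R}) (t : R) : set T :=
  [set w | exists l, prob P [set v | X l w < X l v] < t].

Lemma unif_marginE (X : {RV P >-> R}) (w : T) :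
  fine (cdf X (X w)) = 1 - prob P [set v | X w < X v].
Proof.
rewrite /cdf /distribution /pushforward.
rewrite (_ : _ @^-1` _ = ~` [set v | X w < X v]).
  rewrite -[LHS]/(prob P _) prob_setC//.
  exact: (measurable_tail1 (fun _ : 'I_1 => X) ord0).
by apply/seteqP; split => v /=; rewrite in_itv/= => h;
   [apply/negP; rewrite -leNgt|rewrite leNgt; apply/negP].
Qed.

(** With [t] <= 1 the threshold is nonnegative, so the initial value 0 never exceeds it, even for an
    empty block. *)
Lemma bigmax_unif_gt (m : nat) (X : 'I_m -> {RV P >-> R}) (t : R) (w : T) : t <= 1 ->
  1 - t < \big[Num.max/0]_(l < m) fine (cdf (X l) (X l w)) <-> block_exceeds X t w.
Proof.
move=> t1; split => [|[l Xl]].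
  move=> h; apply: contrapT => /forallNP nX.
  move: h; rewrite ltNge => /negP; apply; apply/bigmax_leP; split; first by lra.
  move=> l _; rewrite unif_marginE; have /negP := nX l; rewrite -leNgt; lra.
apply: lt_le_trans (le_bigmax _ _ l); rewrite unif_marginE; lra.
Qed.

Lemma block_excess_event (d : nat) (p : 'I_d -> nat) (Z : blocks p {RV P >-> R})
    (j : 'I_d) (t : R) : t <= 1 ->
  block_excess Z j t = t^-1 * prob P (block_exceeds (Z j) t).
Proof.
move=> t1; congr (_ * fine (P _)); apply/seteqP.
by split => w /(bigmax_unif_gt (Z j) w t1).
Qed.

Lemma joint_excess_event (d : nat) (p : 'I_d -> nat) (Z : blocks p {RV P >-> R})
    (t : R) : t <= 1 ->
  joint_excess Z t = t^-1 * prob P (union_over predT (fun j => block_exceeds (Z j) t)).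
Proof.
move=> t1; congr (_ * fine (P _)); apply/seteqP; split => w /=; last first.
  move=> [j [_ /(bigmax_unif_gt (Z j) w t1) h]].
  by apply: lt_le_trans (le_bigmax _ _ j); exact: h.
move=> h; apply: contrapT => nZ; move: h; rewrite ltNge => /negP; apply.
apply/bigmax_leP; split => [|j _]; first by lra.
rewrite leNgt; apply/negP => /(bigmax_unif_gt (Z j) w t1) h.
by apply: nZ; exists j.
Qed.

Lemma excess_blocks (d : nat) (p : 'I_d -> nat) (Z : blocks p {RV P >-> R})
    (a : pred 'I_d) (t : R) :
  excess (flatten_blocks Z) (fun i => a (tag i)) (fun=> 1) t =
  t^-1 * prob P (union_over a (fun j => block_exceeds (Z j) t)).
Proof.
congr (_ * prob _ _); apply/seteqP; split => w.
  move=> [[j l] [aj]]; rewrite /rank_excess/= mulr1 => h.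
  by exists j; split => //; exists l.
move=> [j [aj [l h]]]; exists (Tagged (fun i => 'I_(p i)) l).
by rewrite /rank_excess/= mulr1.
Qed.

End block_events.

Lemma cvg_at_right0_eq (R : realType) (f g : R -> R) (l : R) :
  g t @[t --> 0^'+] --> l ->
  (forall t, 0 < t -> t <= 1 -> f t = g t) ->
  f t @[t --> 0^'+] --> l.
Proof.
move=> gl fg; apply: cvg_trans gl; apply: near_eq_cvg; near=> t.
have t0 : 0 < t by near: t; exact: nbhs_right_gt.
by rewrite fg//; near: t; exact: nbhs_right_le.
Unshelve. all: by end_near. Qed.

Section seco_coefficients.
Context (R : realType) (d : nat) (p : 'I_d -> nat)
  (dsp : measure_display) (T : measurableType dsp) (P : probability T R).
Implicit Type Z : blocks p {RV P >-> R}.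
Local Notation I := (coord p).
Local Notation in_block j := (fun i : I => tag i == j).

Section attracted_blocks.
Variable Z : blocks p {RV P >-> R}.
Arguments Z : clear implicits.
Context (dspV : measure_display) (TV : measurableType dspV)
  (PV : probability TV R) (V : I -> {RV PV >-> R}).
Hypothesis stableV : max_stable_tail V.
Hypothesis nondegV : forall i, exists r, 0 < tail1 V i r < 1.
Hypothesis ZV : attracted (flatten_blocks Z) V.

Let cvg_coefficient A : excess (flatten_blocks Z) A (fun=> 1) t @[t --> 0^'+] -->
  extremal_coefficient (flatten_blocks Z) A.
Proof. exact: (is_cvg_excess1 stableV nondegV ZV). Qed.

Lemma joint_excess_cvg : joint_excess Z t @[t --> 0^'+] -->
  extremal_coefficient (flatten_blocks Z) predT.
Proof.
apply: (cvg_at_right0_eq (@cvg_coefficient predT)) => t _ t1.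
by rewrite joint_excess_event// -excess_blocks.
Qed.

Lemma block_excess_cvg j : block_excess Z j t @[t --> 0^'+] -->
  extremal_coefficient (flatten_blocks Z) (in_block j).
Proof.
apply: (cvg_at_right0_eq (@cvg_coefficient (in_block j))) => t _ t1.
rewrite block_excess_event// (excess_blocks Z (pred1 j)); congr (_ * prob _ _).
apply/seteqP; split => w; first by exists j; split => //=; exact: eqxx.
by move=> [k [/eqP ->]].
Qed.

Lemma theta_jointE : theta_joint Z = extremal_coefficient (flatten_blocks Z) predT.
Proof. exact/cvg_lim/joint_excess_cvg. Qed.

Lemma thetaE j : theta Z j = extremal_coefficient (flatten_blocks Z) (in_block j).
Proof. exact/cvg_lim/block_excess_cvg. Qed.

Lemma attracted_seco_well_defined : seco_well_defined Z.
Proof.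
split; first by apply/cvg_ex; eexists; exact: joint_excess_cvg.
by move=> j; apply/cvg_ex; eexists; exact: block_excess_cvg.
Qed.

(** Its - ln is the indicator of the blocks in [a], so the stable tail dependence function there is
    the extremal coefficient of their union. *)
Definition unit_corner (a : pred 'I_d) : blocks p R :=
  fun j _ => if a j then expR (- 1) else 1.

Lemma unit_corner01 a j l : 0 < @unit_corner a j l <= 1.
Proof.
rewrite /unit_corner; case: (a j); last by rewrite ltr01 lexx.
by rewrite expR_gt0 expR_le1 lerN10.
Qed.

Lemma ev_copula_unit_corner a : ev_copula Z (unit_corner a) =
  expR (- extremal_coefficient (flatten_blocks Z) (fun i => a (tag i))).
Proof.
rewrite /ev_copula ifT; last first.
  by apply/forallP => j; apply/forallP => l; exact: unit_corner01.
congr (expR (- _)); apply/cvg_lim => //.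
apply: (cvg_at_right0_eq (@cvg_coefficient (fun i => a (tag i)))) => t t0 t1.
congr (_ * fine (P _)); apply/seteqP; split => w /=.
  move=> [j [l]]; rewrite /unif_margin unif_marginE /unit_corner => h.
  (* Outside [a] the level is 0, and a value of a distribution function never exceeds 1. *)
  case: (boolP (a j)) h => [aj|_]; last first.
    by rewrite ln1 oppr0 mulr0 subr0 ltNge gerBl prob_ge0.
  rewrite expRK opprK => h; exists (Tagged (fun i => 'I_(p i)) l); split => //.
  suff : prob P [set v | Z j l w < Z j l v] < t * 1 by [].
  lra.
move=> [[j l] [aj]]; rewrite /rank_excess/= => h; exists j, l.
rewrite /unif_margin unif_marginE /unit_corner; move: aj => /= ->.
rewrite expRK opprK.
have : prob P [set v | Z j l w < Z j l v] < t * 1 := h.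
lra.
Qed.

End attracted_blocks.

Definition seco_of_copula (C : blocks p R -> R) : R :=
  \sum_(j < d) - ln (C (unit_corner (pred1 j))) + ln (C (unit_corner predT)).

Lemma seco_copula Z H : in_mda Z H -> seco Z = seco_of_copula (ev_copula Z).
Proof.
move=> /in_mda_flat[dspV [TV [PV [V [_ sV nV ZV]]]]].
rewrite /seco /seco_of_copula (theta_jointE sV nV ZV) !(ev_copula_unit_corner sV nV ZV) expRK.
congr (_ + _); apply: eq_bigr => j _.
by rewrite (thetaE sV nV ZV) (ev_copula_unit_corner sV nV ZV) expRK opprK.
Qed.

End seco_coefficients.

(** * Symmetry, independence and additional blocks *)


Section permutations.
Context (R : realType) (d : nat) (p : 'I_d -> nat)
  (dsp : measure_display) (T : measurableType dsp) (P : probability T R).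

Lemma bigmax_perm (n : nat) (s : 'S_n) (F : 'I_n -> R) (x : R) :
  \big[Num.max/x]_(i < n) F (s i) = \big[Num.max/x]_(i < n) F i.
Proof.
apply/eqP; rewrite eq_le; apply/andP; split.
  by apply/bigmax_leP; split => [|i _]; [exact: bigmax_ge_id|exact: (le_bigmax x F (s i))].
apply/bigmax_leP; split => [|i _]; first exact: bigmax_ge_id.
by rewrite -(permKV s i); exact: (le_bigmax x (fun i => F (s i)) (s^-1%g i)).
Qed.

Lemma seco_perm_blocks (pi : 'S_d) (Z : blocks p {RV P >-> R}) :
  seco (p := fun j => p (pi j)) (fun j => Z (pi j)) = seco Z.
Proof.
rewrite /seco; congr (_ - _).
  by rewrite [RHS](reindex_inj (@perm_inj _ pi)).
rewrite /theta_joint.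
suff -> : joint_excess (p := fun j => p (pi j)) (fun j => Z (pi j)) = joint_excess Z by [].
apply/funext => t.
congr (_ * fine (P _)); apply/seteqP.
by split => w /=; rewrite -(bigmax_perm pi (fun j => \big[Num.max/0]_(l < p j) unif_margin Z l w)).
Qed.

(** The data enter only through the block maxima, which permutations inside a block and increasing
    transformations preserve. *)
Lemma eq_excess (Z W : blocks p {RV P >-> R}) :
  (forall j w, \big[Num.max/0]_(l < p j) unif_margin Z l w =
               \big[Num.max/0]_(l < p j) unif_margin W l w) ->
  joint_excess Z = joint_excess W /\ block_excess Z = block_excess W.
Proof.
move=> ZW; split.
  apply/funext => t; congr (_ * fine (P _)); apply/funext => w /=.
  by under eq_bigr => j _ do rewrite ZW.
by apply/funext => j; apply/funext => t; congr (_ * fine (P _)); apply/funext => w /=; rewrite ZW.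
Qed.

End permutations.

Section seco_properties.
Context (R : realType) (d : nat) (p : 'I_d -> nat)
  (dsp : measure_display) (T : measurableType dsp) (P : probability T R).

Lemma seco_eq_bigmax (Z W : blocks p {RV P >-> R}) :
  (forall j w, \big[Num.max/0]_(l < p j) unif_margin Z l w =
               \big[Num.max/0]_(l < p j) unif_margin W l w) ->
  seco Z = seco W.
Proof.
by move=> /eq_excess[jE bE]; rewrite /seco /theta /theta_joint jE bE.
Qed.

Lemma seco_perm_in_block (Z : blocks p {RV P >-> R}) (j : 'I_d) (s : 'S_(p j)) :
  seco (p := p) (dfwith Z j (fun l => Z j (s l))) = seco Z.
Proof.
apply: seco_eq_bigmax => k w; rewrite /unif_margin.
have [jk|jk] := eqVneq j k; last by rewrite dfwithout.
(* Eliminating the equality makes the dependent types of blocks [j] and [k] coincide. *)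
case: _ / jk; rewrite dfwithin.
exact: (bigmax_perm s (fun l => fine (cdf (Z j l) (Z j l w)))).
Qed.

(** Strict increase makes Y v <= Y w equivalent to X v <= X w, so both sides measure the same
    event. *)
Lemma unif_margin_incr (f : R -> R) (X Y : {RV P >-> R}) (w : T) :
  {homo f : x y / x < y} -> (forall v, Y v = f (X v)) ->
  fine (cdf Y (Y w)) = fine (cdf X (X w)).
Proof.
move=> /le_mono/= f_mono YX; rewrite /cdf /distribution /pushforward.
by congr (fine (P _)); apply/seteqP; split => v /=; rewrite !in_itv/= !YX f_mono.
Qed.

Section one_vector.
Variables (Z : blocks p {RV P >-> R}) (H : blocks p R -> R).
Hypothesis hZ : in_mda Z H.

Lemma in_mda_seco_well_defined : seco_well_defined Z.
Proof.
have [dspV [TV [PV [V [_ sV nV ZV]]]]] := in_mda_flat hZ.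
exact: attracted_seco_well_defined sV nV ZV.
Qed.

Lemma in_mda_theta j :
  theta Z j = extremal_coefficient (flatten_blocks Z) (fun i => tag i == j).
Proof.
have [dspV [TV [PV [V [_ sV nV ZV]]]]] := in_mda_flat hZ.
exact: thetaE sV nV ZV j.
Qed.

Lemma in_mda_theta_joint :
  theta_joint Z = extremal_coefficient (flatten_blocks Z) predT.
Proof.
have [dspV [TV [PV [V [_ sV nV ZV]]]]] := in_mda_flat hZ.
exact: theta_jointE sV nV ZV.
Qed.

Lemma seco_ge0 : 0 <= seco Z.
Proof.
have [dspV [TV [PV [V [_ sV nV ZV]]]]] := in_mda_flat hZ.
rewrite subr_ge0 in_mda_theta_joint.
under eq_bigr do rewrite in_mda_theta.
exact: (coefficient_partition_ge sV nV ZV (fun i : coord p => tag i)).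
Qed.

Lemma theta_le_joint j : theta Z j <= theta_joint Z.
Proof.
have [dspV [TV [PV [V [_ sV nV ZV]]]]] := in_mda_flat hZ.
rewrite in_mda_theta in_mda_theta_joint.
exact: (coefficient_sub sV nV ZV).
Qed.

Lemma seco_eq0 : seco Z = 0 <-> mutually_asymp_indep H.
Proof.
have [dspV [TV [PV [V [HV sV nV ZV]]]]] := in_mda_flat hZ.
have part := coefficient_partition_eq sV nV ZV (fun i : coord p => tag i).
have -> : seco Z = 0 <-> \sum_(j < d) extremal_coefficient (flatten_blocks Z)
    [pred i | tag i == j] = extremal_coefficient (flatten_blocks Z) predT.
  rewrite /seco in_mda_theta_joint; under eq_bigr do rewrite in_mda_theta.
  by split => [/eqP|->]; [rewrite subr_eq0 => /eqP|rewrite subrr].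
rewrite part; split => [fac x|ind y].
  rewrite HV fac; apply: eq_bigr => j _.
  by rewrite (marginE HV).
rewrite -(unflattenK y) -HV ind; apply: eq_bigr => j _.
by rewrite (marginE HV).
Qed.

End one_vector.

End seco_properties.

(** * Appending a block *)

Section one_more_block.
Context (R : realType) (d : nat) (p : 'I_d -> nat) (m : nat).

(** The two families have types that agree only after rewriting; an [f] defined for all sizes, with
    values in a fixed type, compares them without casts. *)
Lemma rcons_block_lift (T C : Type) (f : forall n, ('I_n -> T) -> C)
    (x : blocks p T) (y : 'I_m -> T) (j : 'I_d) :
  f _ (@rcons_block d p m T x y (lift ord_max j)) = f _ (x j).
Proof. by rewrite /rcons_block /rcons_size liftK. Qed.

Context (dsp : measure_display) (T : measurableType dsp) (P : probability T R).

Lemma theta_rcons (Z : blocks p {RV P >-> R}) (Znew : 'I_m -> {RV P >-> R}) j :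
  theta (rcons_block Z Znew) (lift ord_max j) = theta Z j.
Proof.
exact: (rcons_block_lift (fun n (X : 'I_n -> {RV P >-> R}) =>
  lim (t^-1 * fine (P [set w | \big[Num.max/0]_(l < n) fine (cdf (X l) (X l w)) > 1 - t])
       @[t --> 0^'+]))).
Qed.

(** Reading the original vector inside the enlarged one lets a single limit law govern both. *)
Lemma joint_excess_rcons (Z : blocks p {RV P >-> R}) (Znew : 'I_m -> {RV P >-> R})
    (t : R) : t <= 1 ->
  joint_excess Z t = excess (flatten_blocks (rcons_block Z Znew))
    (fun i => tag i != ord_max) (fun=> 1) t.
Proof.
move=> t1; rewrite joint_excess_event// (excess_blocks _ (predC1 ord_max)).
have lifted j : block_exceeds (@rcons_block d p m _ Z Znew (lift ord_max j)) t = block_exceeds (Z j) t.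
  exact: (rcons_block_lift (fun n (X : 'I_n -> {RV P >-> R}) => block_exceeds X t)).
congr (_ * prob _ _); apply/seteqP; split => w.
  by move=> [j [_ Zj]]; exists (lift ord_max j); rewrite lifted /= eq_sym neq_lift.
move=> [k [/= kmax Zk]]; case: (unliftP ord_max k) Zk kmax => [j ->|->]; last by rewrite eqxx.
by rewrite lifted => Zj _; exists j.
Qed.

Section appended.
Variables (Z : blocks p {RV P >-> R}) (Znew : 'I_m -> {RV P >-> R})
  (K : blocks (rcons_size p m) R -> R).
Hypothesis hK : in_mda (rcons_block Z Znew) K.

Let is_last (i : coord (rcons_size p m)) := tag i == ord_max.

(** The coefficients of the old blocks cancel; the gap of the partition old against new remains,
    labelled by booleans. *)
Lemma seco_rcons : seco (rcons_block Z Znew) - seco Z =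
  \sum_(b : bool) extremal_coefficient (flatten_blocks (rcons_block Z Znew))
     [pred i | is_last i == b]
  - extremal_coefficient (flatten_blocks (rcons_block Z Znew)) predT.
Proof.
have [dspV [TV [PV [V [_ sV nV ZV]]]]] := in_mda_flat hK.
rewrite /seco big_ord_recr/= (in_mda_theta_joint hK) (in_mda_theta hK) big_bool.
rewrite (eq_bigr (theta Z)); last first.
  move=> j _; rewrite -(theta_rcons Z Znew); congr theta.
  by apply: val_inj; rewrite /= /bump leqNgt ltn_ord.
have -> : theta_joint Z = extremal_coefficient (flatten_blocks (rcons_block Z Znew))
    [pred i | is_last i == false].
  apply/cvg_lim => //.
  have cvgc := @is_cvg_excess1 _ _ _ _ _ _ _ _ _ _ sV nV ZV [pred i | is_last i == false].
  apply: cvg_at_right0_eq cvgc _ => t _ t1.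
  rewrite (joint_excess_rcons _ Znew)//; congr excess.
  by apply/funext => i /=; rewrite /is_last; case: (tag i == ord_max).
have -> : (fun i : coord (rcons_size p m) => tag i == ord_max) = [pred i | is_last i == true].
  by apply/funext => i /=; rewrite /is_last; case: (tag i == ord_max).
rewrite -[X in _ = X - _]/(_ + _); ring.
Qed.

Lemma seco_rcons_ge : seco Z <= seco (rcons_block Z Znew).
Proof.
have [dspV [TV [PV [V [_ sV nV ZV]]]]] := in_mda_flat hK.
rewrite -subr_ge0 seco_rcons subr_ge0.
exact: (coefficient_partition_ge sV nV ZV is_last).
Qed.

Lemma seco_rcons_eq : seco (rcons_block Z Znew) = seco Z <-> asymp_indep_last K.
Proof.
have [dspV [TV [PV [V [KV sV nV ZV]]]]] := in_mda_flat hK.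
have -> : seco (rcons_block Z Znew) = seco Z <-> factorizes V is_last.
  rewrite -(coefficient_partition_eq sV nV ZV); split => [/eqP|/eqP].
    by rewrite -subr_eq0 seco_rcons subr_eq0 => /eqP.
  by rewrite -subr_eq0 -seco_rcons subr_eq0 => /eqP.
have margins (x : blocks (rcons_size p m) R) :
    \prod_(b : bool) (1 - tail V [pred i | is_last i == b] (flatten_blocks x)) =
    margin K (fun k _ => k != ord_max) x * margin K (fun k _ => k == ord_max) x.
  rewrite big_bool mulrC !(marginE KV).
  by congr ((1 - _) * (1 - _)); apply: eq_tail => // i /=; rewrite /is_last; case: (tag i == ord_max).
split => [fac x|ind y]; first by rewrite -margins -fac KV.
by rewrite -(unflattenK y) margins -ind KV.
Qed.

End appended.
End one_more_block.

Theorem proposition1 (R : realType) (d : nat) (p : 'I_d -> nat)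
    (hd : (0 < d)%N) (hp : forall j, (0 < p j)%N)
    (dsp : measure_display) (Omega : measurableType dsp)
    (P : probability Omega R) (Z : blocks p {RV P >-> R})
    (H : blocks p R -> R) (hZ : in_mda Z H) :
  (* A1 *)
  ((forall pi : 'S_d,
      seco (p := fun j => p (pi j)) (fun j => Z (pi j)) = seco Z) /\
   (forall (j : 'I_d) (s : 'S_(p j)),
      seco (p := p) (dfwith Z j (fun l => Z j (s l))) = seco Z)) /\
  (* A2 *)
  (0 <= seco Z /\
   ((seco Z)%:E <=
      \big[Order.min/+oo]_(j < d) (\sum_(k < d | k != j) theta Z k)%:E)%E) /\
  (* A3 *)
  (seco Z = 0 <-> mutually_asymp_indep H) /\
  (* A4 *)
  (forall (m : nat) (hm : (0 < m)%N) (Znew : 'I_m -> {RV P >-> R})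
      (K : blocks (rcons_size p m) R -> R),
      in_mda (rcons_block Z Znew) K ->
      seco Z <= seco (rcons_block Z Znew) /\
      (seco (rcons_block Z Znew) = seco Z <-> asymp_indep_last K)) /\
  (* A5 *)
  (exists Phi : (blocks p R -> R) -> R,
    forall (dsp' : measure_display) (Omega' : measurableType dsp')
      (P' : probability Omega' R) (Z' : blocks p {RV P' >-> R})
      (H' : blocks p R -> R),
      in_mda Z' H' ->
      seco_well_defined Z' /\ seco Z' = Phi (ev_copula Z')) /\
  (* A6 *)
  (forall (f : blocks p (R -> R)) (W : blocks p {RV P >-> R}),
      (forall j l, {homo f j l : x y / x < y}) ->
      (forall j l, continuous (f j l)) ->
      (forall j l w, W j l w = f j l (Z j l w)) ->
      seco_well_defined W /\ seco W = seco Z) /\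
  (* A8 *)
  (forall (dspn : nat -> measure_display)
      (Omegan : forall n, measurableType (dspn n))
      (Pn : forall n, probability (Omegan n) R)
      (Zn : forall n, blocks p {RV (Pn n) >-> R})
      (Hn : nat -> blocks p R -> R),
      (forall n, in_mda (Zn n) (Hn n)) ->
      unif_cube_cvg (fun n => ev_copula (Zn n)) (ev_copula Z) ->
      seco (Zn n) @[n --> \oo] --> seco Z).
Proof.
split; [|split; [|split; [|split; [|split; [|split]]]]].
- by split; [move=> pi; exact: seco_perm_blocks|move=> j s; exact: seco_perm_in_block].
- split; first exact: seco_ge0 hZ.
  (* For block [j], the left side minus the right side is theta of [j] minus the joint
     coefficient. *)
  apply: le_bigmin => [|j _]; first exact: leey.
  rewrite lee_fin /seco (bigD1 j)//= addrAC gerDr subr_le0.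
  exact: theta_le_joint hZ j.
- exact: seco_eq0 hZ.
- by move=> m _ Znew K hK; split; [exact: seco_rcons_ge hK|exact: seco_rcons_eq hK].
- exists (@seco_of_copula R d p) => dsp' Omega' P' Z' H' hZ'.
  by split; [exact: in_mda_seco_well_defined hZ'|exact: seco_copula hZ'].
- move=> f W f_incr _ Wf.
  have uW j w : \big[Num.max/0]_(l < p j) unif_margin W l w =
                \big[Num.max/0]_(l < p j) unif_margin Z l w.
    by apply: eq_bigr => l _; exact: unif_margin_incr (f_incr j l) (Wf j l).
  split; last exact: seco_eq_bigmax.
  have [jE bE] := eq_excess uW; rewrite /seco_well_defined jE bE.
  exact: in_mda_seco_well_defined hZ.
- move=> dspn Omegan Pn Zn Hn hn Cn; rewrite (seco_copula hZ).
  have corner a : ev_copula (Zn n) (@unit_corner R d p a) @[n --> \oo]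
      --> ev_copula Z (@unit_corner R d p a).
    apply/cvgrPdist_lt => e e0; apply: filterS (Cn e e0) => n.
    rewrite distrC; apply => j l.
    by have /andP[/ltW -> ->] := @unit_corner01 R d p a j l.
  have lnC a : ln (ev_copula (Zn n) (@unit_corner R d p a)) @[n --> \oo]
      --> ln (ev_copula Z (@unit_corner R d p a)).
    (* The limiting copula value is an exponential, hence positive. *)
    apply: (cvg_comp _ _ (corner a)); apply: continuous_ln.
    have [dspV [TV [PV [V [_ sV nV ZV]]]]] := in_mda_flat hZ.
    by rewrite (ev_copula_unit_corner sV nV ZV) expR_gt0.
  under eq_fun do rewrite (seco_copula (hn _)).
  apply: cvgD; last exact: lnC.
  by apply: cvg_big => [|j _]; [exact: add_continuous|apply: cvgN; exact: lnC].
Qed.
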